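(* For every dimension $n$ there exist constants $A_n,B_n$ depending only on $n$ such that the following holds. Let $(M,g)=\mathbb H^n_\kappa$ be the standard $n$-dimensional hyperbolic space of constant curvature $-\kappa^2$, $\kappa>0$, and let $\Omega$ be a bounded domain in $\mathbb H^n_\kappa$ with $C^1$ boundary. Then $$\mu_j\le A_n\left(\frac{j}{|\Omega|}\right)^{\frac4n}+B_n\kappa^4$$ for all $j\in\mathbb N$, where $\mu_j$ are the biharmonic Neumann eigenvalues of $\Omega$.
   Context: A domain is a connected open set; $\mathbb N$ is the set of positive integers; $|\Omega|$ is the Riemannian volume. $H^2(\Omega)$ is the completion of $C^\infty(\Omega)$ (functions with finite norm) with respect to $\left(\int_\Omega(|D^2f|^2+|\nabla f|^2+f^2)dv\right)^{1/2}$, with $D^2$ the Hessian and $dv$ the Riemannian volume element. The biharmonic Neumann eigenvalues $\mu_1\le\mu_2\le\cdots$ (repeated with multiplicity) are the eigenvalues of $\int_\Omega(\langle D^2u,D^2\phi\rangle+\mathrm{Ric}(\nabla u,\nabla\phi))dv=\mu\int_\Omega u\phi\,dv$ for all $\phi\in H^2(\Omega)$, with $u\in H^2(\Omega)$, $\mu\in\mathbb R$, that is $$\mu_j=\min_{\substack{U\subset H^2(\Omega)\\ \dim U=j}}\max_{0\ne u\in U}\frac{\int_\Omega(|D^2u|^2+\mathrm{Ric}(\nabla u,\nabla u))dv}{\int_\Omega u^2dv}.$$ *)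

(* Defs.v *)
From HB Require Import structures.
From mathcomp Require Import all_boot all_order all_algebra.
From mathcomp Require Import all_classical all_reals all_analysis.

Set Implicit Arguments.
Unset Strict Implicit.
Unset Printing Implicit Defensive.

Import Order.TTheory GRing.Theory Num.Theory.
Import numFieldNormedType.Exports.

Local Open Scope classical_set_scope.
Local Open Scope ring_scope.

(* Row vectors carry the sigma-algebra generated by the coordinates, i.e. the
   Borel sigma-algebra of R^n. *)
Section measurable_rV.
Context {R : realType}.
Variable n : nat.

Definition rV_coord (i : 'I_n) (x : 'rV[R]_n) : measurableTypeR R := x ord0 i.

Let rV_set0 : g_sigma_preimage rV_coord set0.
Proof. exact: sigma_algebra0. Qed.

Let rV_setC A : g_sigma_preimage rV_coord A -> g_sigma_preimage rV_coord (~` A).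
Proof. exact: sigma_algebraC. Qed.

Let rV_bigcup (F : _^nat) : (forall i, g_sigma_preimage rV_coord (F i)) ->
  g_sigma_preimage rV_coord (\bigcup_i (F i)).
Proof. exact: sigma_algebra_bigcup. Qed.

Definition measure_rV_display : measure_display.
Proof. exact: (measure_tuple_display default_measure_display). Qed.

HB.instance Definition _ := @isMeasurable.Build measure_rV_display
  'rV[R]_n (g_sigma_preimage rV_coord) rV_set0 rV_setC rV_bigcup.

Lemma measurable_rV_coord (i : 'I_n) : measurable_fun [set: 'rV[R]_n] (rV_coord i).
Proof.
move=> _ Y mY; rewrite setTI; apply: sub_sigma_algebra => /=.
rewrite -bigcup_seq/=; exists i => /=; first by rewrite mem_index_enum.
by exists Y => //; rewrite setTI.
Qed.

Lemma measurable_to_rV d (T : measurableType d) (f : T -> 'rV[R]_n) :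
  (forall i, measurable_fun setT (rV_coord i \o f)) -> measurable_fun setT f.
Proof.
move=> mf _ A mA; rewrite setTI.
suff: [set B | measurable (f @^-1` B)] A by [].
apply: mA; split=> [|A0].
  split => /=.
  - by rewrite preimage_set0.
  - by move=> B; rewrite setTD preimage_setC => /measurableC.
  - by move=> F mF; rewrite preimage_bigcup; exact: bigcup_measurable.
rewrite -bigcup_seq/= => -[i _ [B mB <-]].
rewrite setTI -comp_preimage -[X in measurable X]setTI.
exact: mf.
Qed.

End measurable_rV.

(* n-dimensional Lebesgue measure, by induction on n: R^(n+1) = R * R^n. *)
Section lebesgue_rV.
Context {R : realType}.

Definition rV_cons n (p : measurableTypeR R * 'rV[R]_n) : 'rV[R]_n.+1 :=
  row_mx (p.1 : R)%:M p.2.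

Definition rV_uncons n (x : 'rV[R]_n.+1) : measurableTypeR R * 'rV[R]_n :=
  (x ord0 ord0, \row_i x ord0 (lift ord0 i)).

Lemma rV_cons0 n p : @rV_cons n p ord0 ord0 = p.1.
Proof.
rewrite /rV_cons (_ : ord0 = lshift n (ord0 : 'I_1)); last exact/val_inj.
by rewrite (@row_mxEl _ 1 1 n) mxE eqxx mulr1n.
Qed.

Lemma rV_consS n p i : @rV_cons n p ord0 (lift ord0 i) = p.2 ord0 i.
Proof.
rewrite /rV_cons (_ : lift ord0 i = rshift 1 i); last exact/val_inj.
by rewrite (@row_mxEr _ 1 1 n).
Qed.

Lemma rV_consK n : cancel (@rV_cons n) (@rV_uncons n).
Proof.
move=> [a v]; rewrite /rV_uncons rV_cons0/=; congr pair.
by apply/rowP => i; rewrite mxE rV_consS.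
Qed.

Lemma measurable_rV_cons n : measurable_fun setT (@rV_cons n).
Proof.
apply: measurable_to_rV => i.
have [->|[j ->]] : i = ord0 \/ exists j, i = lift ord0 j.
- by case: (unliftP ord0 i) => [j ->|->]; [right; exists j|left].
- rewrite (_ : _ \o _ = fst); first exact: measurable_fst.
  by apply/funext => p; exact: rV_cons0.
- rewrite (_ : _ \o _ = rV_coord j \o snd).
    by apply: measurableT_comp; [exact: measurable_rV_coord|exact: measurable_snd].
  by apply/funext => p; exact: rV_consS.
Qed.

Lemma measurable_rV_uncons n : measurable_fun setT (@rV_uncons n).
Proof.
apply: measurable_fun_pair => /=; first exact: (measurable_rV_coord ord0).
apply: measurable_to_rV => i.
rewrite (_ : _ \o _ = rV_coord (lift ord0 i)); first exact: measurable_rV_coord.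
by apply/funext => x; rewrite /rV_coord/= mxE.
Qed.

Section step.
Variables (n : nat) (m : {sigma_finite_measure set 'rV[R]_n -> \bar R}).

Definition lebesgue_rV_step : set 'rV[R]_n.+1 -> \bar R :=
  pushforward (@lebesgue_measure R \x m)%E (@rV_cons n).

Let m0 : lebesgue_rV_step set0 = 0%E.
Proof. by rewrite /lebesgue_rV_step /pushforward preimage_set0 measure0. Qed.

Let m_ge0 A : (0 <= lebesgue_rV_step A)%E.
Proof. by rewrite /lebesgue_rV_step /pushforward measure_ge0. Qed.

Let m_sigma_additive : semi_sigma_additive lebesgue_rV_step.
Proof.
move=> F mF tF mUF; rewrite /lebesgue_rV_step /pushforward preimage_bigcup.
have mcons A : measurable A -> measurable (@rV_cons n @^-1` A).
  by move=> mA; rewrite -[X in measurable X]setTI; exact: measurable_rV_cons.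
apply: measure_semi_sigma_additive.
- by move=> k; exact: mcons.
- apply/trivIsetP => /= i j _ _ ij; rewrite -preimage_setI.
  by move/trivIsetP : tF => /(_ _ _ _ _ ij) ->//; rewrite preimage_set0.
- by rewrite -preimage_bigcup; exact: mcons.
Qed.

HB.instance Definition _ := isMeasure.Build _ _ _
  lebesgue_rV_step m0 m_ge0 m_sigma_additive.

Let m_sigma_finite : sigma_finite setT lebesgue_rV_step.
Proof.
have /sigma_finiteP[F [TF ndF Foo]] := sigma_finiteT (@lebesgue_measure R).
have /sigma_finiteP[G [TG ndG Goo]] := sigma_finiteT m.
exists (fun k => @rV_uncons n @^-1` (F k `*` G k)).
  rewrite -preimage_bigcup (_ : \bigcup_k _ = setT) ?preimage_setT//.
  rewrite -setXTT TF TG predeqE => -[x y]; split.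
    by move=> [k _ []/= ? ?]; split; exists k.
  move=> [/= [k _ Fkx] [l _ Gly]]; exists (maxn k l) => //; split.
  - by move: x Fkx; exact/subsetPset/ndF/leq_maxl.
  - by move: y Gly; exact/subsetPset/ndG/leq_maxr.
move=> k; have [mF Fk] := Foo k; have [mG Gk] := Goo k; split.
  rewrite -[X in measurable X]setTI; apply: measurable_rV_uncons => //.
  exact: measurableX.
rewrite /lebesgue_rV_step /pushforward -comp_preimage.
rewrite (_ : _ \o _ = id); last by apply/funext => p; exact: rV_consK.
by rewrite preimage_id product_measure1E// lte_mul_pinfty// ge0_fin_numE.
Qed.

HB.instance Definition _ := Measure_isSigmaFinite.Build _ _ _
  lebesgue_rV_step m_sigma_finite.

End step.

Fixpoint lebesgue_rV n : {sigma_finite_measure set 'rV[R]_n -> \bar R} :=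
  match n return {sigma_finite_measure set 'rV[R]_n -> \bar R} with
  | 0 => dirac (0 : 'rV[R]_0)
  | k.+1 => lebesgue_rV_step (lebesgue_rV k)
  end.

End lebesgue_rV.

Section calculus.
Context {R : realType} {n : nat}.
Implicit Types (f : 'rV[R]_n -> R) (D : set 'rV[R]_n).

Definition partial (i : 'I_n) f : 'rV[R]_n -> R :=
  fun x => 'D_(delta_mx 0 i) f x.

(* f is C^oo on the open set D; the values of f outside D are irrelevant. *)
Definition smooth_on D f :=
  forall (s : seq 'I_n) x, D x -> differentiable (foldr partial f s) x.

Definition C1_on D f :=
  forall x, D x -> differentiable f x /\ forall i, {for x, continuous (partial i f)}.

End calculus.

(* A Riemannian metric in a global chart: S is the open domain of the chart
   and g x is the Gram matrix of the coordinate vector fields at x. *)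
Section riemannian.
Context {R : realType} {n : nat}.
Variables (S : set 'rV[R]_n) (g : 'rV[R]_n -> 'M[R]_n).
Implicit Types (f : 'rV[R]_n -> R) (D : set 'rV[R]_n) (x : 'rV[R]_n).

(* Christoffel symbol Gamma^k_ij *)
Definition christoffel (k i j : 'I_n) x : R :=
  2^-1 * \sum_l invmx (g x) k l *
    (partial i (fun y => g y j l) x + partial j (fun y => g y i l) x
     - partial l (fun y => g y i j) x).

(* Components of the gradient vector field. *)
Definition grad f x : 'rV[R]_n := (\row_i partial i f x) *m invmx (g x).

(* Components of the Hessian, as a (0,2)-tensor field. *)
Definition hess f x : 'M[R]_n :=
  \matrix_(i, j) (partial i (partial j f) x -
                  \sum_k christoffel k i j x * partial k f x).

(* R_ij = d_k Gamma^k_ij - d_j Gamma^k_ik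
          + Gamma^k_kl Gamma^l_ij - Gamma^k_jl Gamma^l_ik,
   so that the Ricci tensor of a round sphere is positive. *)
Definition ricci x : 'M[R]_n :=
  \matrix_(i, j) \sum_k
    (partial k (christoffel k i j) x - partial j (christoffel k i k) x
     + \sum_l (christoffel k k l x * christoffel l i j x
               - christoffel k j l x * christoffel l i k x)).

Definition bilin (B : 'M[R]_n) (v w : 'rV[R]_n) : R := (v *m B *m w^T) 0 0.

(* <T, T'> = g^ik g^jl T_ij T'_kl *)
Definition tensor_inner x (T T' : 'M[R]_n) : R :=
  \tr (invmx (g x) *m T *m invmx (g x) *m T'^T).

(* integral over D of F against the Riemannian volume element *)
Definition vol_integral D (F : 'rV[R]_n -> R) : \bar R :=
  (\int[lebesgue_rV n]_(x in D) (F x * Num.sqrt (\det (g x)))%:E)%E.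

Definition riem_volume D : \bar R := vol_integral D (cst 1).

Definition C1_curve (c : R -> 'rV[R]_n) :=
  (forall t, t \in `[0, 1] -> derivable c t 1) /\
  {within `[0, 1], continuous (derive1 c)}.

Definition curve_length (c : R -> 'rV[R]_n) : \bar R :=
  (\int[lebesgue_measure]_(t in `[0%R, 1%R])
     (Num.sqrt (bilin (g (c t)) (derive1 c t) (derive1 c t)))%:E)%E.

Definition riem_dist x y : \bar R :=
  ereal_inf [set curve_length c | c in
    [set c | [/\ C1_curve c, c 0 = x, c 1 = y &
                 forall t, t \in `[0, 1] -> S (c t)]]].

Definition riem_bounded D :=
  exists p (r : R), S p /\ forall x, D x -> (riem_dist p x < r%:E)%E.

Definition is_domain D := [/\ D !=set0, D `<=` S, open D & connected D].

(* Near each of its boundary points, the open set D is the sublevel set of a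
   C^1 function with nonvanishing differential. *)
Definition C1_boundary D :=
  forall p, S p -> closure D p -> ~ D p ->
  exists (V : set 'rV[R]_n) (phi : 'rV[R]_n -> R),
    [/\ open V, V p, C1_on V phi, exists i, partial i phi p != 0 &
        forall x, V x -> D x <-> phi x < 0].

(* Triples (u, X, T) of a function, a vector field and a (0,2)-tensor field. *)
Definition jet : Type :=
  (('rV[R]_n -> R^o) * ('rV[R]_n -> 'rV[R]_n) * ('rV[R]_n -> 'M[R]_n))%type.

Definition jet_of f : jet := (f, grad f, hess f).

(* squared H^2 norm on D *)
Definition H2_sqnorm D (J : jet) : \bar R :=
  vol_integral D (fun x => tensor_inner x (J.2 x) (J.2 x)
    + bilin (g x) (J.1.2 x) (J.1.2 x) + J.1.1 x ^+ 2).

Definition jet_measurable D (J : jet) :=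
  [/\ measurable_fun D (J.1.1 : 'rV[R]_n -> R),
      forall i, measurable_fun D (fun x => J.1.2 x 0 i) &
      forall i j, measurable_fun D (fun x => J.2 x i j)].

(* H^2(D): the completion of { f smooth on D | H2_sqnorm D (jet_of f) < +oo },
   realized inside the complete space of square integrable triples. The map
   f |-> (f, grad f, hess f) being isometric, the completion is the closure of
   its range; an element J = (u, X, T) stands for u with X = grad u and
   T = D^2 u, and J represents 0 iff H2_sqnorm D J = 0. *)
Definition H2 D : set jet := [set J | jet_measurable D J /\
  exists f_ : nat -> 'rV[R]_n -> R,
    (forall k, smooth_on D (f_ k) /\ (H2_sqnorm D (jet_of (f_ k)) < +oo)%E) /\
    H2_sqnorm D (J - jet_of (f_ k)) @[k --> \oo] --> 0%E].

(* U is a j-dimensional subspace of H^2(D), linear independence being modulo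
   elements of zero norm. *)
Definition H2_subspace D (j : nat) (U : set jet) :=
  exists b : 'I_j -> jet,
    [/\ forall i, H2 D (b i),
        forall c : 'I_j -> R,
          H2_sqnorm D (\sum_i c i *: b i) = 0%E -> forall i, c i = 0 &
        U = [set \sum_i c i *: b i | c in [set: 'I_j -> R]]].

Definition rayleigh D (J : jet) : R :=
  fine (vol_integral D (fun x => tensor_inner x (J.2 x) (J.2 x)
                               + bilin (ricci x) (J.1.2 x) (J.1.2 x)))
  / fine (vol_integral D (fun x => J.1.1 x ^+ 2)).

(* The j-th biharmonic Neumann eigenvalue of D (j >= 1), by the min-max formula.
   The supremum over a finite-dimensional U is a maximum; writing the minimum
   over U as an infimum makes the value defined without presupposing that it is
   attained. *)
Definition biharmonic_neumann D (j : nat) : \bar R :=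
  ereal_inf [set ereal_sup [set (rayleigh D J)%:E |
                             J in U `&` [set J | H2_sqnorm D J <> 0%E]] |
             U in H2_subspace D j].

End riemannian.

(* Upper half-space model of the hyperbolic space of dimension n+1 and constant
   curvature -kappa^2: the metric is |dx|^2 / (kappa x_(n+1))^2 on
   { x_(n+1) > 0 }. *)
Section hyperbolic.
Context {R : realType} {n : nat}.

Definition half_space : set 'rV[R]_n.+1 := [set x | 0 < x 0 ord_max].

Definition hyp_metric (kappa : R) (x : 'rV[R]_n.+1) : 'M[R]_n.+1 :=
  ((kappa * x 0 ord_max) ^- 2)%:M.

End hyperbolic.

(* Main.v *)
Require Import Defs.
From HB Require Import structures.
From mathcomp Require Import all_boot all_order all_algebra.
From mathcomp Require Import all_classical all_reals all_analysis.
From mathcomp Require Import measurable_realfun.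
From mathcomp Require Import ring lra.

Set Implicit Arguments.
Unset Strict Implicit.
Unset Printing Implicit Defensive.

Import Order.TTheory GRing.Theory Num.Theory.
Import numFieldNormedType.Exports.

Local Open Scope classical_set_scope.
Local Open Scope ring_scope.

(** A combination of functions with pairwise disjoint supports has a Rayleigh
    quotient at most the greatest of their quotients, so that [j] disjointly
    supported functions on [D] with quotients at most [L] bound the [j]-th
    eigenvalue by [L] ([biharmonic_neumann_le_disjoint]).

    Such functions come from a hyperbolic grid of scale [eps <= 1]. Its [m]-th
    layer is the slab [a (1 + eps)^m <= y < a (1 + eps)^(m+1)], cut into cubes of
    Euclidean side [w = eps a (1 + eps)^m]. The side of a cell is comparable to
    [eps y], so its hyperbolic size is about [eps / kappa] whatever the layer:
    its volume is at most [(eps / kappa)^d] with [d = n + 1]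
    ([rel_vol_cell_le]), and a fixed bump rescaled to the cell has Hessian and
    Ricci terms of order [kappa^4 / eps^4] ([cell_energy_le]). The latter uses
    only that the Christoffel symbols are constants over [y] and the Ricci
    components constants over [y^2]. The bump of a cell lives in a slightly
    larger box, its star, so its Rayleigh quotient is at most a constant times
    [kappa^4 / eps^4] times the ratio of the volumes of [D] in the star and in
    the cell.

    That ratio is bounded for enough cells. Colour the cells by their indices
    modulo 3. Stars of one colour are disjoint ([star_disjoint]), hence their
    volumes add up to at most [|D|]; the cells of all colours cover [D], hence
    one of the [3^d] colours carries volume at least [|D| / 3^d]. In that colour
    the cells with ratio above [2 3^d] carry at most half of this, and each other
    cell carries at most [(eps / kappa)^d], so at least
    [|D| (kappa / eps)^d / (2 3^d)] cells have a small ratio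
    ([select_same_colour]). This number is at least [j] for
    [eps = min 1 (kappa / rho)] with [rho^d = 2 3^d j / |D|], and then
    [kappa^4 / eps^4 <= rho^4 + kappa^4], which is the claim. *)

(** * Boxes and open sets in the space of row vectors *)

Section boxes.
Context {R : realType}.

Definition rV_box n (a b : 'I_n -> R) : set 'rV[R]_n :=
  [set x | forall i, a i <= x ord0 i < b i].

Lemma measurable_rV_box n (a b : 'I_n -> R) : measurable (rV_box a b).
Proof.
have -> : rV_box a b =
    \bigcap_(i in [set: 'I_n]) (@rV_coord R n i @^-1` `[a i, b i[%classic).
  apply/seteqP; split=> [x xab i _|x xab i] /=.
    by rewrite in_itv/=; exact: xab.
  by have := xab i I; rewrite /= in_itv.
apply: fin_bigcap_measurable => // i _; rewrite -[X in measurable X]setTI.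
exact: measurable_rV_coord.
Qed.

Lemma lebesgue_rV_box n (a b : 'I_n -> R) : (forall i, a i <= b i) ->
  lebesgue_rV n (rV_box a b) = (\prod_(i < n) (b i - a i))%:E.
Proof.
elim: n a b => [a b _|n IH a b ab].
  rewrite /= big_ord0 diracE mem_set//=.
  by case.
rewrite big_ord_recl /= /lebesgue_rV_step /pushforward /=.
have -> : @rV_cons R n @^-1` rV_box a b =
    `[a ord0, b ord0[%classic `*`
      rV_box (fun i => a (lift ord0 i)) (fun i => b (lift ord0 i)).
  apply/seteqP; split=> [p pab|p [p1 p2] i] /=.
    split => /=; first by rewrite in_itv/=; have := pab ord0; rewrite rV_cons0.
    by move=> i; have := pab (lift ord0 i); rewrite rV_consS.
  case: (unliftP ord0 i) => [j ->|->]; first by rewrite rV_consS; exact: p2.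
  by rewrite rV_cons0; move: p1; rewrite /= in_itv.
rewrite product_measure1E//; last exact: measurable_rV_box.
rewrite IH//= lebesgue_measure_itv/= lte_fin.
have := ab ord0; rewrite le_eqVlt => /orP[/eqP->|->].
  by rewrite ltxx subrr mul0e mul0r.
by rewrite -EFinB EFinM.
Qed.

(** An open set is the union of the boxes with rational endpoints that it
    contains, and these are countably many. *)
Lemma open_measurable_rV n (A : set 'rV[R]_n) : open A -> measurable A.
Proof.
move=> oA.
pose lo (q : {ffun 'I_n -> rat * rat}) i : R := ratr (q i).1.
pose hi (q : {ffun 'I_n -> rat * rat}) i : R := ratr (q i).2.
have -> : A = \bigcup_(q in [set q | rV_box (lo q) (hi q) `<=` A])
    rV_box (lo q) (hi q).
  apply/seteqP; split=> [x Ax|x [q /= + xq]]; last exact.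
  have /nbhs_ballP[e /= e0 eA] := oA _ Ax.
  have /(_ _)/cid h1 i : exists q : rat, ratr q \in `](x ord0 i - e), (x ord0 i)[.
    by apply: rat_in_itvoo; rewrite ltrBlDr ltrDl.
  have /(_ _)/cid h2 i : exists q : rat, ratr q \in `](x ord0 i), (x ord0 i + e)[.
    by apply: rat_in_itvoo; rewrite ltrDl.
  exists [ffun i => (sval (h1 i), sval (h2 i))].
    move=> y yq; apply: eA; split=> // i j; rewrite (ord1 i).
    have := yq j; rewrite /lo /hi ffunE /=.
    case: (h1 j) (h2 j) => /= q1 + [/= q2]; rewrite !in_itv/=.
    move=> /andP[a1 a2] /andP[b1 b2] /andP[c1 c2].
    rewrite /ball/= ltr_distlC; apply/andP; split; lra.
  move=> i; rewrite /lo /hi ffunE /=.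
  case: (h1 i) (h2 i) => /= q1 + [/= q2]; rewrite !in_itv/=.
  by move=> /andP[a1 a2] /andP[b1 b2]; rewrite (ltW a2).
rewrite bigcup_mkcond; apply: countable_bigcupT_measurable.
  exact: countableP.
by move=> q; case: ifP => // _; exact: measurable_rV_box.
Qed.

Lemma continuous_measurable_rV n (D : set 'rV[R]_n) (f : 'rV[R]_n -> R) :
  open D -> (forall x, D x -> {for x, continuous f}) -> measurable_fun D f.
Proof.
move=> oD cf; apply: (measurability _ (RGenOpens.measurableE R)).
move=> _ [_ [a [b ->] <-]]; apply: open_measurable_rV.
rewrite openE => x [Dx /= fx]; apply: filterI.
  by apply: open_nbhs_nbhs.
by apply: (cf _ Dx); apply: open_nbhs_nbhs; split => //; exact: interval_open.
Qed.

Lemma lebesgue_rV_open_gt0 n (A : set 'rV[R]_n) : open A -> A !=set0 ->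
  (0 < lebesgue_rV n A)%E.
Proof.
move=> oA [x Ax]; have /nbhs_ballP[e /= e0 eA] := oA _ Ax.
pose a i := x ord0 i; pose b i := x ord0 i + e / 2.
have ab i : a i <= b i by rewrite lerDl divr_ge0// ltW.
apply: (@lt_le_trans _ _ (lebesgue_rV n (rV_box a b))).
  rewrite lebesgue_rV_box// lte_fin prodr_gt0// => i _.
  by rewrite /a /b addrAC subrr add0r divr_gt0.
apply: le_measure; rewrite ?inE; [exact: measurable_rV_box|
  exact: open_measurable_rV|].
move=> y yab; apply: eA; split=> // i j; rewrite (ord1 i).
have /andP[] := yab j; rewrite /a /b => ? ?.
rewrite /ball/= ltr_distlC; apply/andP; split; lra.
Qed.

End boxes.

(** * Riemannian balls of the half-space model *)

Section riemannian_ball.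
Context {R : realType}.

Lemma scalar_bilin m (a : R) (v w : 'rV[R]_m) :
  bilin a%:M v w = a * \sum_i v 0 i * w 0 i.
Proof.
rewrite /bilin mul_mx_scalar -scalemxAl !mxE; congr (_ * _).
by apply: eq_bigr => i _; rewrite !mxE.
Qed.

Lemma cvg_sqr {T : Type} (F : set_system T) {FF : Filter F} (f : T -> R) (l : R) :
  f x @[x --> F] --> l -> f x ^+ 2 @[x --> F] --> l ^+ 2.
Proof. by move=> fl; rewrite expr2; under eq_fun do rewrite expr2; exact: cvgM. Qed.

(** The bound on the derivative is integrated by the fundamental theorem of
    calculus; with [s] the speed of a curve, the right-hand side is its length. *)
Lemma variation_le_integral (phi dphi s : R -> R) :
  (forall t : R, t \in `[0, 1] -> is_derive t 1 phi (dphi t)) ->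
  {within `[0, 1], continuous dphi} ->
  {within `[0, 1], continuous s} ->
  (forall t : R, t \in `[0, 1] -> `|dphi t| <= s t) ->
  ((`|phi 1 - phi 0|)%:E <=
    \int[lebesgue_measure]_(t in `[0%R, 1%R]) (s t)%:E)%E.
Proof.
move=> dphiE cdphi cs dphi_s.
have mI : measurable (`[0%R, 1%R]%classic : set (measurableTypeR R)).
  exact: measurable_itv.
have mdphi : @measurable_fun _ _ (measurableTypeR R) (measurableTypeR R)
    `[0%R, 1%R]%classic dphi.
  exact: subspace_continuous_measurable_fun.
have FTC : (\int[lebesgue_measure]_(t in `[0%R, 1%R]) (dphi t)%:E =
    (phi 1)%:E - (phi 0)%:E)%E.
  have cphi (t : R) : t \in `[0, 1] -> {for t, continuous phi}.
    move=> t01; apply: differentiable_continuous; apply/derivable1_diffP.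
    by have [] := dphiE t t01.
  apply: continuous_FTC2 => //.
    split.
    - move=> t t01; have t01' : t \in `[0, 1] by apply: subset_itv_oo_cc.
      by have [] := dphiE t t01'.
    - by apply: cvg_at_right_filter; apply: cphi; rewrite in_itv/= lexx ler01.
    - by apply: cvg_at_left_filter; apply: cphi; rewrite in_itv/= lexx ler01.
  move=> t t01; have t01' : t \in `[0, 1] by apply: subset_itv_oo_cc.
  by rewrite derive1E; have [] := dphiE t t01'.
rewrite -abse_EFin EFinB -FTC.
apply: (@le_trans _ _ (\int[lebesgue_measure]_(t in `[0%R, 1%R]) `|(dphi t)%:E|)%E).
  apply: le_abse_integral => //; exact/measurable_EFinP.
apply: ge0_le_integral => //.
- exact/measurable_EFinP/measurableT_comp.
- by apply/measurable_EFinP; exact: subspace_continuous_measurable_fun.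
Qed.

Lemma sqr_le_normr_sqrt (a b : R) : a ^+ 2 <= b -> `|a| <= Num.sqrt b.
Proof. by move=> ab; rewrite -sqrtr_sqr ler_wsqrtr. Qed.

(** The functions [ln y] and [ln (y^2 + (x_i - p_i)^2)] have hyperbolic
    gradients of norm at most [kappa] and [2 kappa], so along a curve of length
    less than [r] they vary by at most [kappa r] and [2 kappa r]. The second one
    controls the horizontal displacement without a bound on the height of the
    curve in between. *)
Lemma riem_dist_log_bounds n (kappa r : R) (p x : 'rV[R]_n.+1) :
  0 < kappa -> half_space p ->
  (riem_dist half_space (hyp_metric kappa) p x < r%:E)%E ->
  let y := x 0 ord_max in let q := p 0 ord_max in
  [/\ 0 < y, `|ln y - ln q| <= kappa * r &
   forall i, i != ord_max ->
     ln (y ^+ 2 + (x 0 i - p 0 i) ^+ 2) <= ln (q ^+ 2) + 2 * (kappa * r)].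
Proof.
move=> k0 q0 /ereal_inf_lt[_ [c [[dc cc] c0 c1 cS] <-] len] y q.
have y_gt0 : 0 < y by rewrite /y -c1; apply: cS; rewrite in_itv/= ler01 lexx.
pose X i t : R := c t 0 i; pose V i t : R := derive1 c t 0 i.
have dX i (t : R) : t \in `[0, 1] -> is_derive t 1 (X i) (V i t).
  move=> t01; have dct := dc t t01; apply: DeriveDef.
    by have /derivable_mxP := dct; exact.
  by rewrite /V derive1E derive_mx// mxE.
have at0 : (0 : R) \in `[0, 1] by rewrite in_itv/= lexx ler01.
have at1 : (1 : R) \in `[0, 1] by rewrite in_itv/= lexx ler01.
have cX i (t : R) : t \in `[0, 1] -> X i s @[s --> within `[0 : R, 1]%classic (nbhs t)] --> X i t.
  move=> t01; apply: cvg_within_filter.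
  apply: differentiable_continuous; apply/derivable1_diffP.
  by have [] := dX i t t01.
have cV i (t : R) : t \in `[0, 1] -> V i s @[s --> within `[0 : R, 1]%classic (nbhs t)] --> V i t.
  move=> t01; have /subspace_continuousP/(_ t) := cc; move=> /(_ t01) cvt.
  have := @coord_continuous _ _ _ 0 i (derive1 c t).
  exact: (cvg_comp _ _ cvt).
have XS (t : R) : t \in `[0, 1] -> 0 < X ord_max t by move=> /cS.
have speedE t : bilin (hyp_metric kappa (c t)) (derive1 c t) (derive1 c t) =
    (kappa * X ord_max t) ^- 2 * \sum_i V i t ^+ 2.
  by rewrite /hyp_metric scalar_bilin.
have c_speed : {within `[0, 1], continuous (fun t : R => Num.sqrt
    ((kappa * X ord_max t) ^- 2 * \sum_i V i t ^+ 2))}.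
  apply/subspace_continuousP => t t01.
  apply: continuous_cvg; first exact: sqrt_continuous.
  apply: cvgM.
    apply: cvgV; first by rewrite gt_eqF// exprn_gt0// mulr_gt0// XS.
    by apply: cvg_sqr; apply: cvgM; [exact: cvg_cst|exact: cX].
  by apply: cvg_big => [|i _]; [exact: add_continuous|apply: cvg_sqr; exact: cV].
(* Both estimates integrate a bound of the derivative by the speed. *)
have bound (f df : R -> R) : (forall t : R, t \in `[0, 1] -> is_derive t 1 f (df t)) ->
    (forall t : R, t \in `[0, 1] ->
       df s @[s --> within `[0 : R, 1]%classic (nbhs t)] --> df t) ->
    (forall t : R, t \in `[0, 1] -> df t ^+ 2 <=
       (kappa * X ord_max t) ^- 2 * \sum_i V i t ^+ 2) ->
    `|f 1 - f 0| <= r.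
  move=> dfE cdf le_df; rewrite -lee_fin; apply: le_trans (ltW len).
  rewrite /curve_length; under eq_integral do rewrite speedE.
  apply: variation_le_integral dfE _ _ _.
  - by apply/subspace_continuousP => t; exact: cdf.
  - exact: c_speed.
  - by move=> t t01; apply: sqr_le_normr_sqrt; exact: le_df.
have k_neq0 : kappa != 0 by rewrite gt_eqF.
split=> //.
- pose f (t : R) := kappa^-1 * ln (X ord_max t).
  have : `|f 1 - f 0| <= r.
  apply: (bound f (fun t => kappa^-1 * ((X ord_max t)^-1 * V ord_max t))).
  + move=> t t01; apply: is_deriveZ.
    exact: (@is_derive1_comp R _ _ _ _ _ (is_derive1_ln (XS t t01)) (dX ord_max t t01)).
  + move=> t t01; apply: cvgM; first exact: cvg_cst.
    apply: cvgM; last exact: cV.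
    by apply: cvgV; [rewrite gt_eqF// XS|exact: cX].
  + move=> t t01; rewrite mulrA -invfM exprMn exprVn.
    rewrite ler_wpM2l ?invr_ge0 ?sqr_ge0// (bigD1 ord_max)//= lerDl.
    by apply: sumr_ge0 => i _; exact: sqr_ge0.
  rewrite /f /X c0 c1 -mulrBr normrM gtr0_norm ?invr_gt0//.
  by rewrite mulrC ler_pdivrMr// mulrC.
- move=> i imax.
  pose D (t : R) := X ord_max t ^+ 2 + (X i t - p 0 i) ^+ 2.
  have D0 (t : R) : t \in `[0, 1] -> 0 < D t.
    by move=> t01; rewrite ltr_pwDl ?sqr_ge0// exprn_gt0// XS.
  pose dD (t : R) := 2 * (X ord_max t * V ord_max t + (X i t - p 0 i) * V i t).
  pose f (t : R) := (2 * kappa)^-1 * ln (D t).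
  have : `|f 1 - f 0| <= r.
  apply: (bound f (fun t => (2 * kappa)^-1 * ((D t)^-1 * dD t))).
  + move=> t t01; apply: is_deriveZ.
    apply: (@is_derive1_comp R _ _ _ _ _ (is_derive1_ln (D0 t t01))).
    have dm := dX ord_max t t01; have di := dX i t t01.
    rewrite /D; apply: is_derive_eq.
    rewrite /GRing.scale/= /dD; ring.
  + move=> t t01; apply: cvgM; first exact: cvg_cst.
    have cm := cX ord_max t t01; have ci := cX i t t01.
    have cVm := cV ord_max t t01; have cVi := cV i t t01.
    have cB : X i s - p 0 i @[s --> within `[0 : R, 1]%classic (nbhs t)] --> X i t - p 0 i.
      by apply: cvgB => //; exact: cvg_cst.
    apply: cvgM.
      apply: cvgV; first by rewrite gt_eqF// D0.
      by rewrite /D; apply: cvgD; exact: cvg_sqr.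
    apply: cvgM; first exact: cvg_cst.
    by apply: cvgD; apply: cvgM.
  + move=> t t01.
    apply: (@le_trans _ _ ((kappa * X ord_max t) ^- 2 * (V ord_max t ^+ 2 + V i t ^+ 2))).
      have Xm := XS t t01; have Dt := D0 t t01.
      have -> : ((2 * kappa)^-1 * ((D t)^-1 * dD t)) ^+ 2 = kappa ^- 2 *
          ((X ord_max t * V ord_max t + (X i t - p 0 i) * V i t) ^+ 2 / D t ^+ 2).
        rewrite /dD; field; rewrite ?gt_eqF//.
      rewrite [(kappa * X ord_max t) ^+ 2]exprMn [X in _ <= X * _]invfM -[leRHS]mulrA.
      rewrite ler_wpM2l ?invr_ge0 ?sqr_ge0//.
      rewrite ler_pdivrMr ?exprn_gt0// -mulrA ler_pdivlMl ?exprn_gt0//.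
      rewrite /D; set a := X ord_max t; set b := X i t - p 0 i.
      set v := V ord_max t; set w := V i t.
      rewrite [(a ^+ 2 + b ^+ 2) ^+ 2]expr2 [leRHS]mulrCA ler_pM ?sqr_ge0//.
        by rewrite lerDl sqr_ge0.
      rewrite -subr_ge0 (_ : _ - _ = (a * w - b * v) ^+ 2) ?sqr_ge0//; ring.
    rewrite ler_wpM2l ?invr_ge0 ?sqr_ge0// (bigD1 ord_max)//= (bigD1 i)/= ?imax// addrA lerDl.
    by apply: sumr_ge0 => j _; exact: sqr_ge0.
  rewrite /f /D /X c0 c1 subrr expr0n/= addr0 -mulrBr normrM gtr0_norm;
    last by rewrite invr_gt0 mulr_gt0.
  rewrite mulrC ler_pdivrMr ?mulr_gt0// => /ler_normlP[_].
  by rewrite lerBlDl => /le_trans; apply; rewrite lerD2l; lra.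
Qed.

Lemma riem_bounded_coordinates n (kappa : R) (D : set 'rV[R]_n.+1) :
  0 < kappa -> riem_bounded half_space (hyp_metric kappa) D ->
  exists (a b : R), [/\ 0 < a, 0 < b & forall x, D x ->
    a <= x 0 ord_max /\ forall i, `|x 0 i| <= b].
Proof.
move=> k0 [p [r [pS Dr]]]; set q := p 0 ord_max.
have q0 : 0 < q by [].
have E0 := expR_gt0 (kappa * r).
exists (q * expR (- (kappa * r))), (q * expR (kappa * r) + \sum_i `|p 0 i|).
have S0 : 0 <= \sum_i `|p 0 i| by apply: sumr_ge0.
split=> [||x Dx]; first by rewrite mulr_gt0// expR_gt0.
  by rewrite ltr_pwDl// mulr_gt0.
have /= [] := riem_dist_log_bounds k0 pS (Dr x Dx).
set y := x 0 ord_max; move=> y0; rewrite ler_norml => /andP[lo hi] hi'.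
split.
  rewrite -ler_ln ?posrE ?mulr_gt0 ?expR_gt0//.
  by rewrite lnM ?posrE ?expR_gt0// expRK; rewrite -/q in lo; lra.
move=> i; have [->|imax] := eqVneq i ord_max.
  rewrite gtr0_norm// -/y (le_trans (y := q * expR (kappa * r))) ?lerDl//.
  rewrite -ler_ln ?posrE ?mulr_gt0 ?expR_gt0//.
  by rewrite lnM ?posrE ?expR_gt0// expRK; rewrite -/q in hi; lra.
have le_sqr : (x 0 i - p 0 i) ^+ 2 <= (q * expR (kappa * r)) ^+ 2.
  apply: (@le_trans _ _ (y ^+ 2 + (x 0 i - p 0 i) ^+ 2)).
    by rewrite lerDr sqr_ge0.
  have y2 : 0 < y ^+ 2 + (x 0 i - p 0 i) ^+ 2.
    by rewrite ltr_pwDl ?sqr_ge0// exprn_gt0.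
  rewrite -ler_ln ?posrE ?exprn_gt0 ?mulr_gt0//.
  rewrite (le_trans (hi' _ imax))// exprMn [leRHS]lnM ?posrE ?exprn_gt0//.
  by rewrite lerD2l lnXn ?expR_gt0// expRK mulr_natl.
have le_abs : `|x 0 i - p 0 i| <= q * expR (kappa * r).
  have /le_trans := sqr_le_normr_sqrt le_sqr; apply.
  by rewrite sqrtr_sqr ger0_norm// mulr_ge0// ltW.
rewrite -[x 0 i](subrK (p 0 i)) (le_trans (ler_normD _ _))// lerD//.
by rewrite (bigD1 i)//= lerDl sumr_ge0.
Qed.

End riemannian_ball.

(** * A smooth bump on the line *)

Section bump.
Context {R : realType}.
Implicit Types (f g : R -> R) (x t : R).

Lemma expn_le_fact_expR k x : 0 <= x -> x ^+ k * expR (- x) <= k`!%:R.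
Proof.
move=> x0; rewrite expRN ler_pdivrMr ?expR_gt0//.
case: k => [|k]; first by rewrite expr0 mul1r -[leLHS]expR0 ler_expR.
rewrite mulrC -ler_pdivrMr ?ltr0n ?fact_gt0//.
by apply: le_trans (expR_ge1Dxn k x0); rewrite lerDr.
Qed.

(** For [k = 0] this is the classical smooth function that is flat at the
    origin; the other values of [k] are there to express its derivatives. *)
Definition flat k x : R := if 0 < x then x^-1 ^+ k * expR (- x^-1) else 0.

Lemma flat_ge0 k x : 0 <= flat k x.
Proof.
rewrite /flat; case: ifPn => // x0.
by rewrite mulr_ge0 ?expR_ge0// exprn_ge0// invr_ge0 ltW.
Qed.

Lemma flat_bounded k x : `|flat k x| <= k`!%:R.
Proof.
rewrite ger0_norm ?flat_ge0// /flat; case: ifPn => // x0.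
by rewrite expn_le_fact_expR// invr_ge0 ltW.
Qed.

(** This quadratic bound makes [flat k] differentiable at the origin, with
    derivative 0. *)
Lemma flat_le_sqr k x : flat k x <= k.+2`!%:R * x ^+ 2.
Proof.
rewrite /flat; case: ifPn => x0; last by rewrite mulr_ge0// sqr_ge0.
have -> : x^-1 ^+ k = x^-1 ^+ k.+2 * x ^+ 2.
  by rewrite -addn2 exprD -mulrA -exprMn mulVf ?gt_eqF// expr1n mulr1.
rewrite mulrAC ler_wpM2r ?sqr_ge0// expn_le_fact_expR// invr_ge0 ltW//.
Qed.

Lemma is_derive_flat k x :
  is_derive x 1 (flat k) (flat k.+2 x - k%:R * flat k.+1 x).
Proof.
have [x0|x0|->] := ltgtP x 0.
- rewrite {2 3}/flat !ltNge (ltW x0)/= mulr0 subr0.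
  apply: (@near_eq_is_derive _ _ _ (cst 0)).
    near=> y; rewrite /flat ifF//; apply/negbTE; rewrite -leNgt ltW//.
    by near: y; exact: lt_nbhsl.
- rewrite {2 3}/flat x0.
  apply: (@near_eq_is_derive R R R (fun y : R => y^-1 ^+ k * expR (- y^-1))).
    by near=> y; rewrite /flat ifT//; near: y; exact: lt_nbhsr.
  have x0' : x != 0 by rewrite gt_eqF.
  have dV : is_derive x 1 (fun y : R => y^-1) (- x ^- 2).
    by apply: is_derive_eq (is_deriveV x0' (is_derive_id x 1)) _; exact: mulr1.
  have dN : is_derive x 1 (fun y : R => - y^-1) (x ^- 2).
    by apply: is_derive_eq (is_deriveN dV) _; rewrite opprK.
  have dE := @is_derive1_comp R expR _ x _ _ (is_derive_expR _) dN.
  have dX := @is_deriveX R R (fun y : R => y^-1) k x 1 _ dV.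
  rewrite exprfctE in dX.
  apply: is_derive_eq (is_deriveM dX dE) _.
  rewrite /GRing.scale /= /comp; case: k {dX} => [|k]; rewrite /= ?mulr0n.
    by rewrite expr2; field.
  by rewrite !exprS -mulr_natl; field.
- (* The difference quotient is at most [C |h|] by [flat_le_sqr]. *)
  suff cv : h^-1 *: (flat k (h *: 1 + 0) - flat k 0) @[h --> 0^'] --> (0 : R).
    rewrite {2 3}/flat !ltxx mulr0 subr0.
    apply: DeriveDef; first by apply/cvg_ex; exists 0.
    exact: cvg_lim.
  rewrite {2}/flat ltxx; apply/cvgr0Pnorm_le => /= e e0.
  pose C : R := k.+2`!%:R.
  have C0 : 0 < C by rewrite ltr0n fact_gt0.
  near=> h.
  have h0 : h != 0 by near: h; exact: nbhs_dnbhs_neq.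
  have he : `|h| < e / C.
    by near: h; apply: dnbhs0_lt; rewrite divr_gt0.
  rewrite subr0 addr0 /GRing.scale /= mulr1 normrM normfV.
  rewrite mulrC ler_pdivrMr ?normr_gt0// ger0_norm ?flat_ge0//.
  rewrite (le_trans (flat_le_sqr _ _))// -/C -real_normK ?num_real// expr2 mulrA.
  by rewrite ler_wpM2r// mulrC -ler_pdivlMr// ltW.
Unshelve. all: by end_near. Qed.

(** A class of functions closed under differentiation, all of whose members are
    smooth and bounded. *)
Inductive flat_algebra : (R -> R) -> Prop :=
| flat_algebra_gen k a b : flat_algebra (fun t => flat k (a * t + b))
| flat_algebraD f g : flat_algebra f -> flat_algebra g ->
    flat_algebra (fun t => f t + g t)
| flat_algebraZ c f : flat_algebra f -> flat_algebra (fun t => c * f t)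
| flat_algebraM f g : flat_algebra f -> flat_algebra g ->
    flat_algebra (fun t => f t * g t).

Lemma flat_algebra_bounded f : flat_algebra f ->
  exists2 C, 0 <= C & forall t, `|f t| <= C.
Proof.
elim=> {f}[k a b|f g _ [C C0 fC] _ [D D0 gD]|c f _ [C C0 fC]|
    f g _ [C C0 fC] _ [D D0 gD]].
- by exists k`!%:R => // t; exact: flat_bounded.
- exists (C + D) => [|t]; first exact: addr_ge0.
  by rewrite (le_trans (ler_normD _ _))// lerD.
- by exists (`|c| * C) => [|t]; [rewrite mulr_ge0|rewrite normrM ler_wpM2l].
- by exists (C * D) => [|t]; [rewrite mulr_ge0|rewrite normrM ler_pM].
Qed.

Lemma flat_algebra_derive f : flat_algebra f ->
  exists2 g, flat_algebra g & forall t, is_derive t 1 f (g t).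
Proof.
elim=> {f}[k a b|f g ? [f' ? df] ? [g' ? dg]|c f ? [f' ? df]|
    f g ? [f' ? df] ? [g' ? dg]].
- exists (fun t => a * (flat k.+2 (a * t + b) + - k%:R * flat k.+1 (a * t + b))).
    by do 2 constructor; [constructor|do 2 constructor].
  move=> t; rewrite mulrC mulNr.
  have da : is_derive t 1 (fun t => a * t + b) a.
    by apply: is_derive_eq; rewrite addr0 /GRing.scale/= mulr1.
  by apply: (@is_derive1_comp R (flat k)); exact: is_derive_flat.
- by exists (fun t => f' t + g' t) => [|t]; [constructor|exact: is_deriveD].
- exists (fun t => c * f' t) => [|t]; first by constructor.
  exact: is_deriveZ.
- exists (fun t => f t * g' t + g t * f' t) => [|t].
    by do 2 constructor.
  exact: is_deriveM.
Qed.

(** The bump is a product of two flat functions vanishing at the ends of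
    the interval [-1/2, 3/2], and [H k] is its [k]-th derivative. *)
Lemma exists_bump : exists (H : nat -> R -> R) (c : R),
  [/\ 0 < c,
      forall k t, is_derive t 1 (H k) (H k.+1 t),
      forall k, exists2 C, 0 <= C & forall t, `|H k t| <= C,
      forall k t, ~~ (- 2^-1 <= t <= 3 / 2) -> H k t = 0 &
      forall t, 0 <= t <= 1 -> c <= H 0%N t].
Proof.
pose h t := flat 0 (1 * t + 2^-1) * flat 0 (- 1 * t + 3 / 2).
pose H k := iter k (@derive1 R R) h.
have HA k : flat_algebra (H k) /\ forall t, is_derive t 1 (H k) (H k.+1 t).
  have step f : flat_algebra f ->
      flat_algebra (derive1 f) /\ forall t, is_derive t 1 f (derive1 f t).
    move=> /flat_algebra_derive[g Ag dg].
    have -> : derive1 f = g by apply/funext => t; rewrite derive1E derive_val.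
    by split.
  have HS m : H m.+1 = derive1 (H m) by [].
  have Ak : flat_algebra (H k).
    elim: k => [|k IH]; first by rewrite /H/= /h; do 2 constructor.
    by rewrite HS; exact: (step _ IH).1.
  by split; [exact: Ak|move=> t; rewrite HS; exact: (step _ Ak).2].
(* On [0, 1] both arguments of [flat] are at least [1/2], so that each factor
   is at least [exp(-2)]. *)
exists H, (expR (- 4)); split; [exact: expR_gt0|by move=> k; have [] := HA k|
  by move=> k; apply: flat_algebra_bounded; have [] := HA k| |].
- elim=> [t|k IH t].
    rewrite /H/= /h negb_and -!ltNge => /orP[t1|t1].
      by rewrite [flat 0 (1 * t + _)]/flat ifF ?mul0r//; apply/negbTE; lra.
    by rewrite [flat 0 (-1 * t + _)]/flat ifF ?mulr0//; apply/negbTE; lra.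
  rewrite negb_and -!ltNge => tout.
  rewrite /H /= derive1E; apply: (@etrans _ _ ('D_1 (cst 0 : R -> R) t)).
    apply: near_eq_derive; case/orP : tout => t1; near=> s; apply: IH;
      rewrite negb_and -!ltNge; apply/orP; [left|right].
      by near: s; exact: lt_nbhsl.
    by near: s; exact: lt_nbhsr.
  by rewrite derive_cst.
- move=> t /andP[t0 t1]; rewrite /H/= /h.
  have flat_ge x : 2^-1 <= x -> expR (- 2) <= flat 0 x.
    move=> x2; have x0 : 0 < x by lra.
    rewrite /flat x0 expr0 mul1r ler_expR lerN2 invf_ple ?posrE//.
  rewrite (_ : - 4 = - 2 + - 2); last by ring.
  by rewrite expRD ler_pM ?expR_ge0// flat_ge//; lra.
Unshelve. all: by end_near. Qed.

End bump.

(** * Product bumps *)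

Section coordinate_functions.
Context {R : realType} {n : nat}.
Implicit Types (x v : 'rV[R]_n) (i l : 'I_n).

Lemma coord_comp_derive (phi : R -> R) (dphi : R) l x :
  is_derive (x 0 l) 1 phi dphi ->
  differentiable (fun z : 'rV[R]_n => phi (z 0 l)) x /\
  forall v, 'D_v (fun z : 'rV[R]_n => phi (z 0 l)) x = v 0 l * dphi.
Proof.
move=> dp.
have dc : differentiable (fun z : 'rV[R]_n => z 0 l) x by exact: differentiable_coord.
have dphi' : differentiable phi (x 0 l) by apply/derivable1_diffP; case: dp.
have dcomp : differentiable (fun z : 'rV[R]_n => phi (z 0 l)) x.
  exact: (@differentiable_comp _ _ _ _ (fun z : 'rV[R]_n => z 0 l) phi).
split=> // v; rewrite deriveE//.
rewrite (@diff_comp _ _ _ _ (fun z : 'rV[R]_n => z 0 l) phi)//=.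
have -> : 'd (fun z : 'rV[R]_n => z 0 l) x v = v 0 l.
  rewrite -deriveE//.
  have /matrixP/(_ 0 l) := derive_mx (@derivable_id _ _ x v).
  by rewrite derive_id mxE => <-.
by rewrite diff1E// derive1E derive_val.
Qed.

Lemma prod_differentiable (g : 'I_n -> 'rV[R]_n -> R) (r : seq 'I_n) (P : pred 'I_n) x :
  (forall l, P l -> differentiable (g l) x) ->
  differentiable (fun z => \prod_(l <- r | P l) g l z) x.
Proof.
move=> dg; elim: r => [|l r IH].
  rewrite (_ : (fun z => _) = cst 1); last by apply/funext => z; rewrite big_nil.
  exact: differentiable_cst.
case Pl : (P l); last first.
  by rewrite (_ : (fun z => _) = (fun z => \prod_(l <- r | P l) g l z))//;
    apply/funext => z; rewrite big_cons Pl.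
rewrite (_ : (fun z => _) = g l * (fun z => \prod_(l <- r | P l) g l z)); last first.
  by apply/funext => z; rewrite big_cons Pl.
exact: differentiableM (dg _ Pl) IH.
Qed.

Lemma prod_derive_eq0 (g : 'I_n -> 'rV[R]_n -> R) (r : seq 'I_n) (P : pred 'I_n) x v :
  (forall l, P l -> is_derive x v (g l) 0) ->
  is_derive x v (fun z => \prod_(l <- r | P l) g l z) 0.
Proof.
move=> dg; elim: r => [|l r IH].
  rewrite (_ : (fun z => _) = cst 1); last by apply/funext => z; rewrite big_nil.
  exact: is_derive_cst.
case Pl : (P l); last first.
  by rewrite (_ : (fun z => _) = (fun z => \prod_(l <- r | P l) g l z))//;
    apply/funext => z; rewrite big_cons Pl.
rewrite (_ : (fun z => _) = g l * (fun z => \prod_(l <- r | P l) g l z)); last first.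
  by apply/funext => z; rewrite big_cons Pl.
apply: is_derive_eq (is_deriveM (dg _ Pl) IH) _.
by rewrite !scaler0 addr0.
Qed.

End coordinate_functions.

Section cell_functions.
Context {R : realType} {n : nat}.
Variable H : nat -> R -> R.
Hypothesis dH : forall k (t : R), is_derive t 1 (H k) (H k.+1 t).
Variables (w : R) (tau : 'I_n -> R).
Implicit Types (z : 'rV[R]_n) (i l : 'I_n) (k : 'I_n -> nat).

(** The product bump of the cell of side [w] and corner [w tau]. The exponents
    [k] record how many times each factor was differentiated: the family of these
    functions is closed under partial derivatives up to scalars, which gives both
    smoothness and bounds on the derivatives. *)
Definition cell_fun k z : R := \prod_l H (k l) (z 0 l / w - tau l).

Let factor_derive (l : 'I_n) (m : nat) z :
  differentiable (fun z : 'rV[R]_n => H m (z 0 l / w - tau l)) z /\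
  forall v, 'D_v (fun z : 'rV[R]_n => H m (z 0 l / w - tau l)) z =
    v 0 l * (w^-1 * H m.+1 (z 0 l / w - tau l)).
Proof.
apply: (@coord_comp_derive _ _ (fun t => H m (t / w - tau l))).
rewrite mulrC; apply: (@is_derive1_comp R (H m) (fun t => t / w - tau l)).
have -> : (fun t => t / w - tau l) = (fun t : R => w^-1 * t - tau l).
  by apply/funext => t; rewrite mulrC.
by apply: is_derive_eq; rewrite subr0 /GRing.scale/= mulr1.
Qed.

Lemma cell_fun_differentiable k z : differentiable (cell_fun k) z.
Proof. by apply: prod_differentiable => l _; exact: (factor_derive l (k l) z).1. Qed.

Lemma partial_cell_fun i k :
  partial i (cell_fun k) = (fun z => w^-1 * cell_fun (fun l => k l + (l == i))%N z).
Proof.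
apply/funext => z; rewrite /partial.
have dfac l : is_derive z (delta_mx 0 i) (fun z : 'rV[R]_n => H (k l) (z 0 l / w - tau l))
    ((l == i)%:R * (w^-1 * H (k l).+1 (z 0 l / w - tau l))).
  have [df Df] := factor_derive l (k l) z; apply: DeriveDef.
    exact: diff_derivable.
  by rewrite Df mxE eqxx.
pose g l := fun z : 'rV[R]_n => H (k l) (z 0 l / w - tau l).
have -> : cell_fun k = g i * (fun z => \prod_(l | l != i) g l z).
  by apply/funext => u; rewrite /cell_fun (bigD1 i).
have d0 : is_derive z (delta_mx 0 i) (fun z => \prod_(l | l != i) g l z) 0.
  apply: prod_derive_eq0 => l li.
  by apply: is_derive_eq (dfac l) _; rewrite (negbTE li) mul0r.
have [_ ->] := is_deriveM (dfac i) d0.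
have -> : cell_fun (fun l => k l + (l == i))%N z =
    H (k i).+1 (z 0 i / w - tau i) * \prod_(l | l != i) g l z.
  rewrite /cell_fun (bigD1 i)//= eqxx addn1; congr (_ * _).
  by apply: eq_bigr => l /negbTE ->; rewrite addn0.
by rewrite scaler0 add0r eqxx mul1r /GRing.scale/=; ring.
Qed.

Lemma partial_scale_cell_fun i c k :
  partial i (fun z => c * cell_fun k z) =
  (fun z => c / w * cell_fun (fun l => k l + (l == i))%N z).
Proof.
apply/funext => z.
have := congr1 (fun f => f z) (partial_cell_fun i k); rewrite /partial => E.
have /diff_derivable dk := cell_fun_differentiable k z.
by rewrite (deriveZ c (dk (delta_mx 0 i))) E /GRing.scale/= mulrA.
Qed.

Lemma cell_fun_smooth (D : set 'rV[R]_n) k : smooth_on D (cell_fun k).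
Proof.
move=> s z _.
have : exists c k', foldr partial (cell_fun k) s = (fun z => c * cell_fun k' z).
  elim: s => [|i s [c [k' /= ->]]].
    by exists 1, k; apply/funext => y; rewrite mul1r.
  by rewrite partial_scale_cell_fun; do 2 eexists.
move=> [c [k' ->]].
apply: (@differentiableM _ _ (cst c)); last exact: cell_fun_differentiable.
exact: differentiable_cst.
Qed.

End cell_functions.

(** * The tensors of the half-space model *)

Section hyperbolic_tensors.
Context {R : realType} {n : nat}.
Variable kappa : R.
Hypothesis kappa_gt0 : 0 < kappa.
Notation g := (@hyp_metric R n kappa).
Notation ht x := (x 0 (@ord_max n)).
Implicit Types (x z : 'rV[R]_n.+1) (i j k l : 'I_n.+1).

Lemma half_space_open : open (@half_space R n).
Proof.
rewrite (_ : half_space = (fun x => ht x) @^-1` [set t : R | 0 < t]); last by [].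
by apply: open_comp => [x _|]; [exact: coord_continuous|exact: open_gt].
Qed.

Lemma hyp_metric_inv x : invmx (g x) = ((kappa * ht x) ^+ 2)%:M.
Proof. by rewrite /hyp_metric invmx_scalar invrK. Qed.

Lemma hyp_metric_vol x : half_space x ->
  Num.sqrt (\det (g x)) = (kappa * ht x) ^- n.+1.
Proof.
move=> x0; have y0 : 0 < kappa * ht x by rewrite mulr_gt0.
have v0 : 0 <= (kappa * ht x)^-1 by rewrite invr_ge0 ltW.
by rewrite det_scalar -!exprVn exprAC sqrtr_sqr ger0_norm ?exprn_ge0.
Qed.

Lemma partial_hyp_metric l i j x : half_space x ->
  partial l (fun z => g z i j) x =
  ((i == j) && (l == ord_max))%:R * (- 2 / (kappa ^+ 2 * ht x ^+ 3)).
Proof.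
rewrite /half_space /= => y0; have y_neq0 : ht x != 0 by rewrite gt_eqF.
have k_neq0 : kappa != 0 by rewrite gt_eqF.
pose phi (t : R) := (i == j)%:R * (kappa * t) ^- 2.
have dphi : is_derive (ht x) 1 phi ((i == j)%:R * (- 2 / (kappa ^+ 2 * ht x ^+ 3))).
  apply: is_deriveZ.
  have dsq : is_derive (ht x) (1 : R) (fun t : R => (kappa * t) ^+ 2) (2 * kappa ^+ 2 * ht x).
    by apply: is_derive_eq; rewrite /GRing.scale/=; ring.
  apply: is_derive_eq (is_deriveV _ dsq) _.
    by rewrite expf_neq0// mulf_neq0.
  by rewrite /GRing.scale/=; field; apply/andP.
rewrite /partial (_ : (fun z => g z i j) = (fun z => phi (ht z))); last first.
  by apply/funext => z; rewrite /hyp_metric !mxE /phi mulr_natl.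
rewrite (coord_comp_derive dphi).2 mxE eqxx/= [ord_max == l]eq_sym.
by case: (i == j); case: (l == ord_max); rewrite /= ?mul0r ?mul1r ?mulr0.
Qed.

(** The Christoffel symbols of the half-space model times the height; they do
    not depend on the curvature. *)
Definition hyp_gamma k i j : R := ((k == ord_max) && (i == j))%:R
  - ((i == ord_max) && (k == j))%:R - ((j == ord_max) && (k == i))%:R.

Lemma hyp_christoffel k i j x : half_space x ->
  christoffel g k i j x = hyp_gamma k i j / ht x.
Proof.
move=> xS; have y_neq0 : ht x != 0 by rewrite gt_eqF.
have k_neq0 : kappa != 0 by rewrite gt_eqF.
rewrite /christoffel (bigD1 k)//= big1 ?addr0; last first.
  by move=> l lk; rewrite hyp_metric_inv mxE eq_sym (negbTE lk) mulr0n mul0r.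
rewrite hyp_metric_inv mxE eqxx mulr1n !partial_hyp_metric// /hyp_gamma.
rewrite (eq_sym j k) (eq_sym i k) ![(_ == _) && (_ == ord_max)]andbC.
by set a := (_ && _)%:R; set b := (_ && _)%:R; set c := (_ && _)%:R; field; apply/andP.
Qed.

Lemma partial_hyp_christoffel l k i j x : half_space x ->
  partial l (christoffel g k i j) x = - ((l == ord_max)%:R * hyp_gamma k i j) / ht x ^+ 2.
Proof.
move=> xS; have y_neq0 : ht x != 0 by rewrite gt_eqF.
rewrite /partial.
transitivity ('D_(delta_mx 0 l) (fun z => hyp_gamma k i j / ht z) x).
  apply: near_eq_derive; near=> z; apply: hyp_christoffel.
  by near: z; apply: open_nbhs_nbhs; split=> //; exact: half_space_open.
have dphi : is_derive (ht x) 1 (fun t : R => hyp_gamma k i j / t)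
    (- hyp_gamma k i j / ht x ^+ 2).
  have d1 := is_deriveV y_neq0 (is_derive_id (ht x) (1 : R)).
  apply: is_derive_eq (is_deriveZ _ d1) _.
  by rewrite /GRing.scale/=; field.
rewrite (coord_comp_derive dphi).2 mxE eqxx/= [ord_max == l]eq_sym.
by rewrite mulrA mulrN.
Unshelve. all: by end_near. Qed.

(** The components of the Ricci tensor times the square of the height; being
    constants, they bound the Ricci term whatever its sign. *)
Definition hyp_ricci i j : R := \sum_k
  (\sum_l (hyp_gamma k k l * hyp_gamma l i j - hyp_gamma k j l * hyp_gamma l i k)
   - (k == ord_max)%:R * hyp_gamma k i j + (j == ord_max)%:R * hyp_gamma k i k).

Lemma hyp_ricciE i j x : half_space x -> ricci g x i j = hyp_ricci i j / ht x ^+ 2.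
Proof.
move=> xS; have y_neq0 : ht x != 0 by rewrite gt_eqF.
rewrite mxE /hyp_ricci mulr_suml; apply: eq_bigr => k _.
rewrite !partial_hyp_christoffel//.
under eq_bigr do rewrite !hyp_christoffel//.
rewrite (_ : \sum_l _ = (\sum_l (hyp_gamma k k l * hyp_gamma l i j -
   hyp_gamma k j l * hyp_gamma l i k)) / ht x ^+ 2); last first.
  by rewrite mulr_suml; apply: eq_bigr => l _; field.
by ring.
Qed.

Lemma tensor_inner_hyp x (T : 'M[R]_n.+1) :
  tensor_inner g x T T = (kappa * ht x) ^+ 4 * \sum_i \sum_j T i j ^+ 2.
Proof.
rewrite /tensor_inner hyp_metric_inv mul_scalar_mx mul_mx_scalar -!scalemxAl.
rewrite scalerA mxtraceZ -exprD; congr (_ * _).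
rewrite /mxtrace; apply: eq_bigr => i _; rewrite mxE; apply: eq_bigr => j _.
by rewrite mxE -expr2.
Qed.

Lemma bilin_sum (B : 'M[R]_n.+1) (v : 'rV[R]_n.+1) :
  bilin B v v = \sum_i \sum_j B i j * v 0 i * v 0 j.
Proof.
rewrite /bilin mxE exchange_big/=; apply: eq_bigr => j _.
rewrite !mxE mulr_suml; apply: eq_bigr => i _; ring.
Qed.

Lemma hyp_grad f x i : grad g f x 0 i = (kappa * ht x) ^+ 2 * partial i f x.
Proof. by rewrite /grad hyp_metric_inv mul_mx_scalar !mxE. Qed.

Lemma hyp_hess f x i j : half_space x -> hess g f x i j =
  partial i (partial j f) x - (\sum_k hyp_gamma k i j * partial k f x) / ht x.
Proof.
move=> xS; rewrite mxE; congr (_ - _); rewrite mulr_suml; apply: eq_bigr => k _.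
by rewrite hyp_christoffel// mulrAC.
Qed.

End hyperbolic_tensors.

(** * Disjointly supported test functions *)

Section real_integrals.
Context d (T : measurableType d) (R : realType).
Variables (mu : {measure set T -> \bar R}) (D : set T).
Hypothesis mD : measurable D.

Lemma Rintegral_sum (I : finType) (F : I -> T -> R) :
  (forall i, mu.-integrable D (EFin \o F i)) ->
  mu.-integrable D (EFin \o (fun x => \sum_i F i x)) /\
  \int[mu]_(x in D) (\sum_i F i x) = \sum_i \int[mu]_(x in D) F i x.
Proof.
move=> iF; elim: (index_enum I) => [|i r [IH1 IH2]].
  rewrite big_nil; split.
    by apply: eq_integrable (integrable0 mu D) => // x _; rewrite /= big_nil.
  by under eq_Rintegral do rewrite big_nil; rewrite Rintegral_cst// mul0r.
rewrite big_cons -IH2 -RintegralD//; split.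
  apply: eq_integrable (integrableD mD (iF i) IH1) => // x _.
  by rewrite /= big_cons EFinD.
by apply: eq_Rintegral => x _; rewrite big_cons.
Qed.

Lemma bounded_mul_integrable (v F : T -> R) (M : R) :
  mu.-integrable D (EFin \o v) -> (forall x, 0 <= v x) ->
  measurable_fun D F -> (forall x, D x -> `|F x| <= M) ->
  mu.-integrable D (EFin \o (fun x => F x * v x)).
Proof.
move=> iv v0 mF FM.
have mv : measurable_fun D v by apply/measurable_EFinP; exact: measurable_int iv.
apply: (@le_integrable _ _ _ mu D mD _ (fun x => M%:E * (EFin \o v) x)%E).
- by apply/measurable_EFinP; exact: measurable_funM.
- move=> x Dx; rewrite /= lee_fin !normrM ler_wpM2r//.
  by rewrite (le_trans (FM x Dx))// ler_norm.
- exact: integrableZl.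
Qed.

End real_integrals.

Section orthogonal_sums.
Context {R : realType} {j : nat}.

(** If at most one of the vectors is nonzero, a quadratic map has no cross
    terms on their combinations. *)
Lemma quadratic_sum_disjoint (V : lmodType R) (q : V -> R) (v : 'I_j -> V)
    (c : 'I_j -> R) :
  (forall a u, q (a *: u) = a ^+ 2 * q u) ->
  (exists i0, forall i, i != i0 -> v i = 0) ->
  q (\sum_i c i *: v i) = \sum_i c i ^+ 2 * q (v i).
Proof.
move=> qZ [i0 vi0].
have q0 : q 0 = 0 by rewrite -(scale0r (0 : V)) qZ expr0n mul0r.
rewrite (bigD1 i0)//= big1 ?addr0 => [|i /vi0 ->]; last by rewrite scaler0.
rewrite (bigD1 i0)//= big1 ?addr0 ?qZ// => i /vi0 ->.
by rewrite q0 mulr0.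
Qed.

End orthogonal_sums.

Section disjoint_test_functions.
Context {R : realType} {n : nat}.
Variable (g : 'rV[R]_n -> 'M[R]_n).
Variable (D : set 'rV[R]_n).
Hypothesis mD : measurable D.
Local Notation mu := (lebesgue_rV n).
Local Notation J f := (jet_of g f).

Definition vol_density (x : 'rV[R]_n) : R := Num.sqrt (\det (g x)).

Definition energy (K : jet) (x : 'rV[R]_n) : R :=
  tensor_inner g x (K.2 x) (K.2 x) + bilin (ricci g x) (K.1.2 x) (K.1.2 x).

Definition H2_density (K : jet) (x : 'rV[R]_n) : R :=
  tensor_inner g x (K.2 x) (K.2 x) + bilin (g x) (K.1.2 x) (K.1.2 x) + K.1.1 x ^+ 2.

Lemma vol_density_ge0 x : 0 <= vol_density x.
Proof. exact: sqrtr_ge0. Qed.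

Hypothesis ivol : mu.-integrable D (EFin \o vol_density).

Lemma fine_vol_integral F :
  fine (vol_integral g D F) = \int[mu]_(x in D) (F x * vol_density x).
Proof. by []. Qed.

Lemma tensor_innerZ x a (T : 'M[R]_n) :
  tensor_inner g x (a *: T) (a *: T) = a ^+ 2 * tensor_inner g x T T.
Proof.
have TZ : (a *: T)^T = a *: T^T by rewrite linearZ.
by rewrite /tensor_inner TZ !(=^~ scalemxAr, =^~ scalemxAl) scalerA mxtraceZ.
Qed.

Lemma bilinZ (B : 'M[R]_n) a (v : 'rV[R]_n) :
  bilin B (a *: v) (a *: v) = a ^+ 2 * bilin B v v.
Proof.
have vZ : (a *: v)^T = a *: v^T by rewrite linearZ.
by rewrite /bilin vZ !(=^~ scalemxAr, =^~ scalemxAl) scalerA mxE.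
Qed.

Lemma jet_sum_fun m (c : 'I_m -> R) (b : 'I_m -> @jet R n) x :
  (\sum_i c i *: b i).1.1 x = \sum_i c i *: ((b i).1.1 x : R^o).
Proof.
have -> : (\sum_i c i *: b i).1.1 = \sum_i c i *: (b i).1.1.
  exact: (big_morph (fun K : @jet R n => K.1.1)).
by rewrite fct_sumE.
Qed.

Lemma jet_sum_field m (c : 'I_m -> R) (b : 'I_m -> @jet R n) x :
  (\sum_i c i *: b i).1.2 x = \sum_i c i *: (b i).1.2 x.
Proof.
have -> : (\sum_i c i *: b i).1.2 = \sum_i c i *: (b i).1.2.
  exact: (big_morph (fun K : @jet R n => K.1.2)).
by rewrite fct_sumE.
Qed.

Lemma jet_sum_tensor m (c : 'I_m -> R) (b : 'I_m -> @jet R n) x :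
  (\sum_i c i *: b i).2 x = \sum_i c i *: (b i).2 x.
Proof.
have -> : (\sum_i c i *: b i).2 = \sum_i c i *: (b i).2.
  exact: (big_morph (fun K : @jet R n => K.2)).
by rewrite fct_sumE.
Qed.

Definition vanishes_at (K : @jet R n) x := [/\ K.1.1 x = 0, K.1.2 x = 0 & K.2 x = 0].

(** At a point where at most one of the jets lives, all the integrands are
    diagonal in the coefficients. *)
Lemma densities_sum m (c : 'I_m -> R) (b : 'I_m -> @jet R n) x :
  (exists i0, forall i, i != i0 -> vanishes_at (b i) x) ->
  let K := \sum_i c i *: b i in
  [/\ K.1.1 x ^+ 2 = \sum_i c i ^+ 2 * (b i).1.1 x ^+ 2,
      energy K x = \sum_i c i ^+ 2 * energy (b i) x &
      H2_density K x = \sum_i c i ^+ 2 * H2_density (b i) x].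
Proof.
move=> [i0 bi0] K.
have E1 : K.1.1 x ^+ 2 = \sum_i c i ^+ 2 * (b i).1.1 x ^+ 2.
  rewrite jet_sum_fun (@quadratic_sum_disjoint _ _ R^o (fun r => r ^+ 2))//.
    by move=> a u; rewrite /GRing.scale/= exprMn.
  by exists i0 => i /bi0[].
have EB (B : 'M[R]_n) : bilin B (K.1.2 x) (K.1.2 x) =
    \sum_i c i ^+ 2 * bilin B ((b i).1.2 x) ((b i).1.2 x).
  rewrite jet_sum_field (@quadratic_sum_disjoint _ _ _ (fun r => bilin B r r))//.
    by move=> a u; exact: bilinZ.
  by exists i0 => i /bi0[].
have ET : tensor_inner g x (K.2 x) (K.2 x) =
    \sum_i c i ^+ 2 * tensor_inner g x ((b i).2 x) ((b i).2 x).
  rewrite jet_sum_tensor (@quadratic_sum_disjoint _ _ _ (fun r => tensor_inner g x r r))//.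
    by move=> a u; exact: tensor_innerZ.
  by exists i0 => i /bi0[].
rewrite /energy /H2_density E1 !EB ET -!big_split/=; split=> //.
  by apply: eq_bigr => i _; rewrite mulrDr.
by apply: eq_bigr => i _; rewrite !mulrDr.
Qed.

Variables (m : nat) (f : 'I_m -> 'rV[R]_n -> R) (A : 'I_m -> set 'rV[R]_n).
Variables (M K L : R).
Hypothesis L_ge0 : 0 <= L.
Hypothesis m_gt0 : (0 < m)%N.
Hypothesis mA : forall i, measurable (A i).
Hypothesis dA : forall i i' x, D x -> A i x -> A i' x -> i = i'.
Hypothesis fA : forall i x, D x -> ~ A i x -> vanishes_at (J (f i)) x.
Hypothesis sf : forall i, smooth_on D (f i).
Hypothesis mJ : forall i, jet_measurable D (J (f i)).
Hypothesis mE : forall i, measurable_fun D (energy (J (f i))).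
Hypothesis mN : forall i, measurable_fun D (H2_density (J (f i))).
Hypothesis EK : forall i x, D x -> energy (J (f i)) x <= K.
Hypothesis EM : forall i x, D x -> `|energy (J (f i)) x| <= M.
Hypothesis NM : forall i x, D x -> f i x ^+ 2 <= H2_density (J (f i)) x <= M.
Local Notation sqmass i := (\int[mu]_(x in D) (f i x ^+ 2 * vol_density x)).
Hypothesis sqmass_gt0 : forall i, 0 < sqmass i.
Hypothesis KL : forall i, K * \int[mu]_(x in D) (\1_(A i) x * vol_density x) <= L * sqmass i.

Lemma disjoint_jets x : D x -> exists i0, forall i, i != i0 -> vanishes_at (J (f i)) x.
Proof.
move=> Dx; have [[i0 Ai0]|nA] := pselect (exists i, A i x).
  exists i0 => i ii0; apply: fA => // Ai.
  by move/eqP : ii0; apply; exact: (dA Dx).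
by exists (Ordinal m_gt0) => i _; apply: fA => // Ai; apply: nA; exists i.
Qed.

Let v0 := vol_density_ge0.

Lemma sqmass_integrable i : mu.-integrable D (EFin \o (fun x => f i x ^+ 2 * vol_density x)).
Proof.
apply: (bounded_mul_integrable mD ivol (M := M)) => //.
  by apply: measurable_funX; have [] := mJ i.
move=> x Dx; have /andP[h1 h2] := NM i Dx.
by rewrite ger0_norm ?sqr_ge0// (le_trans h1).
Qed.

Lemma energy_integrable i :
  mu.-integrable D (EFin \o (fun x => energy (J (f i)) x * vol_density x)).
Proof. by apply: (bounded_mul_integrable mD ivol (M := M)) => // x Dx; exact: EM. Qed.

Lemma H2_integrable i :
  mu.-integrable D (EFin \o (fun x => H2_density (J (f i)) x * vol_density x)).
Proof.
apply: (bounded_mul_integrable mD ivol (M := M)) => // x Dx.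
have /andP[h1 h2] := NM i Dx.
by rewrite ger0_norm// (le_trans _ h1)// sqr_ge0.
Qed.

Lemma indic_integrable i :
  mu.-integrable D (EFin \o (fun x => \1_(A i) x * vol_density x)).
Proof.
apply: (bounded_mul_integrable mD ivol (M := 1)) => // x Dx.
by rewrite ger0_norm// indicE; case: (_ \in _).
Qed.

Lemma integral_comb (c : 'I_m -> R) (F : 'rV[R]_n -> R) (Fi : 'I_m -> 'rV[R]_n -> R) :
  (forall x, D x -> F x = \sum_i c i ^+ 2 * Fi i x) ->
  (forall i, mu.-integrable D (EFin \o (fun x => Fi i x * vol_density x))) ->
  \int[mu]_(x in D) (F x * vol_density x) =
  \sum_i c i ^+ 2 * \int[mu]_(x in D) (Fi i x * vol_density x).
Proof.
move=> FE iF.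
transitivity (\int[mu]_(x in D) (\sum_i c i ^+ 2 * (Fi i x * vol_density x))).
  apply: eq_Rintegral => x /[!inE] Dx; rewrite FE// mulr_suml.
  by apply: eq_bigr => i _; rewrite mulrA.
have iFc i : mu.-integrable D
    (EFin \o (fun x => c i ^+ 2 * (Fi i x * vol_density x))).
  exact: integrableZl (iF i).
have [_ ->] := Rintegral_sum mD iFc.
by apply: eq_bigr => i _; rewrite RintegralZl.
Qed.

Lemma jet_of_H2 i : H2 g D (J (f i)).
Proof.
split; first exact: mJ.
exists (fun=> f i); split.
  move=> _; split=> //.
  by have := integrable_lty mD (H2_integrable i).
have -> : H2_sqnorm g D (J (f i) - J (f i)) = 0%E.
  rewrite subrr.
  rewrite /H2_sqnorm /vol_integral; apply: integral0_eq => x Dx.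
  have -> : (0 : @jet R n).2 x = 0 by [].
  have -> : (0 : @jet R n).1.2 x = 0 by [].
  have -> : (0 : @jet R n).1.1 x = 0 by [].
  by rewrite /tensor_inner /bilin !trmx0 !mulmx0 mxtrace0 mxE expr0n/= !addr0 mul0r.
exact: cvg_cst.
Qed.

(** Integrating the diagonal densities, the quotient of a combination is
    a weighted mean of the quotients of the [f i]. The bound [M] only ensures
    integrability. *)
Lemma biharmonic_neumann_le_disjoint : (biharmonic_neumann g D m <= L%:E)%E.
Proof.
pose U := [set \sum_i c i *: J (f i) | c in [set: 'I_m -> R]].
have denE (c : 'I_m -> R) : \int[mu]_(x in D)
    ((\sum_i c i *: J (f i)).1.1 x ^+ 2 * vol_density x) =
    \sum_i c i ^+ 2 * sqmass i.
  apply: integral_comb; last exact: sqmass_integrable.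
  by move=> x Dx; have [->] := densities_sum c (disjoint_jets Dx).
have HU : H2_subspace g D m U.
  exists (fun i => J (f i)); split=> //; first exact: jet_of_H2.
  move=> c /(congr1 fine) /=; rewrite fine_vol_integral.
  rewrite (@integral_comb c _ (fun i => H2_density (J (f i))))//; last 2 first.
  - by move=> x Dx; have [] := densities_sum c (disjoint_jets Dx).
  - exact: H2_integrable.
  move=> s0 i; apply/eqP.
  have ge0 k : 0 <= c k ^+ 2 * \int[mu]_(x in D) (H2_density (J (f k)) x * vol_density x).
    rewrite mulr_ge0 ?sqr_ge0//; apply: Rintegral_ge0 => x Dx.
    have /andP[h1 h2] := NM k Dx.
    by rewrite mulr_ge0// (le_trans _ h1)// sqr_ge0.
  have /eqP := psumr_eq0P (fun k _ => ge0 k) s0 (i := i) isT.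
  rewrite mulf_eq0 sqrf_eq0 => /orP[//|/eqP N0].
  have := sqmass_gt0 i; rewrite ltNge -N0 => /negP[]; apply: le_Rintegral => //.
  - exact: sqmass_integrable.
  - exact: H2_integrable.
  - by move=> x Dx; rewrite ler_wpM2r//; have /andP[] := NM i Dx.
apply: (@le_trans _ _ (ereal_sup [set (rayleigh g D K)%:E |
    K in U `&` [set K | H2_sqnorm g D K <> 0%E]])).
  by apply: ereal_inf_lbound; exists U.
apply: ge_ereal_sup => _ [_ [[c _ <-] _] <-].
rewrite lee_fin /rayleigh !fine_vol_integral denE.
have den0 : 0 <= \sum_i c i ^+ 2 * sqmass i.
  by apply: sumr_ge0 => i _; rewrite mulr_ge0 ?sqr_ge0 ?ltW.
have num_le : \int[mu]_(x in D) (energy (\sum_i c i *: J (f i)) x * vol_density x)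
    <= L * \sum_i c i ^+ 2 * sqmass i.
  rewrite (@integral_comb c _ (fun i => energy (J (f i))))//; last 2 first.
  - by move=> x Dx; have [] := densities_sum c (disjoint_jets Dx).
  - exact: energy_integrable.
  rewrite mulr_sumr; apply: ler_sum => i _; rewrite mulrCA ler_wpM2l ?sqr_ge0//.
  apply: le_trans (KL i); rewrite -RintegralZl//; last exact: indic_integrable.
  apply: le_Rintegral => //.
  - exact: energy_integrable.
  - by have := integrableZl mD K (indic_integrable i).
  - move=> x Dx; rewrite mulrA ler_wpM2r// indicE.
    have [Ax|nAx] := pselect (A i x); first by rewrite mem_set// mulr1 EK.
    rewrite memNset// mulr0 /energy; have [_ -> ->] := fA Dx nAx.
    by rewrite /tensor_inner /bilin !trmx0 !mulmx0 mxtrace0 mxE addr0.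
have [->|den_neq0] := eqVneq (\sum_i c i ^+ 2 * sqmass i) 0; last first.
  by rewrite ler_pdivrMr// lt_neqAle eq_sym den_neq0.
by rewrite invr0 mulr0.
Qed.

End disjoint_test_functions.

(** * Pointwise bounds on the energy *)

Section pointwise_bounds.
Context {R : realType} {n : nat}.
Variable kappa : R.
Hypothesis kappa_gt0 : 0 < kappa.
Notation g := (@hyp_metric R n kappa).
Notation ht x := (x 0 (@ord_max n)).
Implicit Types (x z : 'rV[R]_n.+1) (i j k l : 'I_n.+1).

Lemma hyp_gamma_le k i j : `|@hyp_gamma R n k i j| <= 3.
Proof.
have b1 (b : bool) : `|b%:R : R| <= 1 by case: b; rewrite ?normr1 ?normr0.
rewrite /hyp_gamma (le_trans (ler_normB _ _))//.
rewrite (_ : 3 = 1 + 1 + 1); last by ring.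
by rewrite lerD ?b1// (le_trans (ler_normB _ _))// lerD ?b1.
Qed.

Definition hess_const : R := n.+1%:R * n.+1%:R * (9 * (1 + n.+1%:R)) ^+ 2.
Definition ricci_const : R := 9 * \sum_i \sum_j `|@hyp_ricci R n i j|.

Lemma hess_const_ge0 : 0 <= hess_const.
Proof. by rewrite !mulr_ge0 ?sqr_ge0. Qed.

Lemma ricci_const_ge0 : 0 <= ricci_const.
Proof. by rewrite mulr_ge0// sumr_ge0// => i _; rewrite sumr_ge0. Qed.

Variables (f : 'rV[R]_n.+1 -> R) (x : 'rV[R]_n.+1) (w eps P : R).
Hypothesis xS : half_space x.
Hypothesis w_gt0 : 0 < w.
Hypothesis eps_gt0 : 0 < eps.
Hypothesis eps_le1 : eps <= 1.
Hypothesis P_ge0 : 0 <= P.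
Hypothesis ht_le : ht x <= 3 * w / eps.
Hypothesis f1 : forall i, `|partial i f x| <= P / w.
Hypothesis f2 : forall i j, `|partial i (partial j f) x| <= P / w ^+ 2.

Let y_gt0 : 0 < ht x. Proof. exact: xS. Qed.
Let y_neq0 : ht x != 0. Proof. by rewrite gt_eqF. Qed.
Let w_neq0 : w != 0. Proof. by rewrite gt_eqF. Qed.
Let e_neq0 : eps != 0. Proof. by rewrite gt_eqF. Qed.
Let p := ht x / w.
Let p_ge0 : 0 <= p. Proof. by rewrite divr_ge0// ltW. Qed.
Let p_le : p <= 3 / eps. Proof. by rewrite /p ler_pdivrMr// mulrAC. Qed.

Let yf1 i : `|ht x * partial i f x| <= 3 * P / eps.
Proof.
rewrite normrM gtr0_norm// (le_trans (ler_wpM2l (ltW y_gt0) (f1 i)))//.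
rewrite (_ : ht x * (P / w) = p * P); last by rewrite /p; ring.
by rewrite (le_trans (ler_wpM2r P_ge0 p_le))// mulrAC.
Qed.

Let eps_inv : eps^-1 <= eps ^- 2.
Proof.
have e1 : 1 <= eps^-1 by rewrite invf_ge1.
by rewrite -exprVn expr2 ler_peMr// invr_ge0 ltW.
Qed.

Let yhess i j : `|ht x ^+ 2 * hess g f x i j| <= 9 * (1 + n.+1%:R) * P / eps ^+ 2.
Proof.
rewrite hyp_hess// mulrBr (le_trans (ler_normB _ _))//.
rewrite (_ : ht x ^+ 2 * (_ / _) = \sum_k hyp_gamma k i j * (ht x * partial k f x)); last first.
  rewrite expr2 -mulrA mulrCA [in RHS](eq_bigr (fun k => ht x * (hyp_gamma k i j * partial k f x))).
    by rewrite -mulr_sumr; field.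
  by move=> k _; rewrite mulrCA.
rewrite (_ : 9 * (1 + n.+1%:R) * P / eps ^+ 2 =
  9 * P / eps ^+ 2 + n.+1%:R * (9 * P / eps ^+ 2)); last by field.
rewrite lerD//.
  rewrite normrM (ger0_norm (sqr_ge0 _)).
  rewrite (le_trans (ler_wpM2l (sqr_ge0 _) (f2 i j)))//.
  rewrite (_ : ht x ^+ 2 * (P / w ^+ 2) = p ^+ 2 * P); last by rewrite /p; field.
  rewrite (_ : 9 * P / eps ^+ 2 = (3 / eps) ^+ 2 * P); last by field.
  by rewrite ler_wpM2r// ler_pXn2r// nnegrE// divr_ge0// ltW.
rewrite (le_trans (ler_norm_sum _ _ _))//.
rewrite (_ : n.+1%:R * _ = \sum_(k < n.+1) (9 * P / eps ^+ 2)); last first.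
  by rewrite sumr_const card_ord mulr_natl.
apply: ler_sum => k _; rewrite normrM (le_trans (ler_pM _ _ (hyp_gamma_le k i j) (yf1 k)))//.
rewrite (_ : 3 * (3 * P / eps) = 9 * P * eps^-1); last by field.
by rewrite ler_wpM2l// mulr_ge0.
Qed.

(** On the support of the bump [y <= 3 w / eps], so that multiplying by [y] each
    derivative of order [1 / w] gives [1 / eps]; the factor [(kappa y)^4] of the
    norm then supplies the powers of [y] that the Hessian requires. *)
Lemma tensor_inner_hess_le :
  tensor_inner g x (hess g f x) (hess g f x) <=
  hess_const * P ^+ 2 * (kappa ^+ 4 / eps ^+ 4).
Proof.
rewrite tensor_inner_hyp//.
rewrite exprMn -[leLHS]mulrA [leRHS](_ : _ = kappa ^+ 4 *
  \sum_(i < n.+1) \sum_(j < n.+1) (9 * (1 + n.+1%:R) * P / eps ^+ 2) ^+ 2); last first.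
  have sumc (a : R) : \sum_(i < n.+1) a = n.+1%:R * a.
    by rewrite sumr_const card_ord mulr_natl.
  by rewrite !sumc /hess_const; move: (n.+1%:R : R) => N; field.
rewrite ler_wpM2l ?exprn_ge0 ?(ltW kappa_gt0)// mulr_sumr ler_sum// => i _.
rewrite mulr_sumr ler_sum// => j _.
rewrite (_ : _ * _ = `|ht x ^+ 2 * hess g f x i j| ^+ 2).
  by rewrite ler_pXn2r// nnegrE// (le_trans _ (yhess i j)).
by rewrite real_normK ?num_real// exprMn -exprM.
Qed.

Lemma ricci_grad_le :
  `|bilin (ricci g x) (grad g f x) (grad g f x)| <=
  ricci_const * P ^+ 2 * (kappa ^+ 4 / eps ^+ 4).
Proof.
rewrite bilin_sum (_ : \sum_i _ = kappa ^+ 4 * \sum_i \sum_j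
    hyp_ricci i j * ((ht x * partial i f x) * (ht x * partial j f x))); last first.
  rewrite mulr_sumr; apply: eq_bigr => i _; rewrite mulr_sumr; apply: eq_bigr => j _.
  by rewrite hyp_ricciE// !hyp_grad//; field.
rewrite normrM ger0_norm ?exprn_ge0 ?(ltW kappa_gt0)//.
rewrite [leRHS](_ : _ = kappa ^+ 4 * (ricci_const * P ^+ 2 / eps ^+ 4)); last by ring.
rewrite ler_wpM2l ?exprn_ge0 ?(ltW kappa_gt0)// (le_trans (ler_norm_sum _ _ _))//.
rewrite /ricci_const (_ : 9 * _ * P ^+ 2 / eps ^+ 4 = \sum_i \sum_j
  `|@hyp_ricci R n i j| * (9 * P ^+ 2 / eps ^+ 4)); last first.
  under [RHS]eq_bigr do rewrite -mulr_suml.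
  by rewrite -mulr_suml; ring.
apply: ler_sum => i _; rewrite (le_trans (ler_norm_sum _ _ _))//.
apply: ler_sum => j _; rewrite normrM ler_wpM2l// normrM.
rewrite (le_trans (ler_pM _ _ (yf1 i) (yf1 j)))//.
rewrite (_ : 3 * P / eps * (3 * P / eps) = 9 * P ^+ 2 * (eps^-1 * eps^-1)); last by ring.
rewrite -mulrA [leRHS](_ : _ = 9 * P ^+ 2 * (eps ^- 2 * eps ^- 2)); last by field.
by rewrite mulrA ler_wpM2l ?mulr_ge0 ?sqr_ge0// ler_pM// invr_ge0 ltW.
Qed.

Lemma metric_grad_le :
  0 <= bilin (g x) (grad g f x) (grad g f x) <=
  n.+1%:R * (kappa * (3 * P / eps)) ^+ 2.
Proof.
rewrite /hyp_metric scalar_bilin.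
rewrite (_ : _ * _ = \sum_i (kappa * (ht x * partial i f x)) ^+ 2); last first.
  have k_neq0 : kappa != 0 by rewrite gt_eqF.
  rewrite mulr_sumr; apply: eq_bigr => i _; rewrite !hyp_grad//.
  by field; apply/andP.
rewrite sumr_ge0 => [|i _]; last exact: sqr_ge0.
rewrite /= [leRHS](_ : _ = \sum_(i < n.+1) (kappa * (3 * P / eps)) ^+ 2); last first.
  by rewrite sumr_const card_ord mulr_natl.
apply: ler_sum => i _; rewrite !exprMn ler_wpM2l ?sqr_ge0//.
rewrite -!exprMn -real_normK ?num_real// ler_pXn2r// ?nnegrE//.
by rewrite (le_trans _ (yf1 i)).
Qed.

Lemma tensor_inner_ge0 (T : 'M[R]_n.+1) : 0 <= tensor_inner g x T T.
Proof.
rewrite tensor_inner_hyp// mulr_ge0//.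
  by rewrite exprn_ge0// mulr_ge0// ltW.
by apply: sumr_ge0 => i _; apply: sumr_ge0 => j _; exact: sqr_ge0.
Qed.

End pointwise_bounds.

(** * The jet of the bump of a cell *)

Section cell_jets.
Context {R : realType} {n : nat}.
Variable kappa : R.
Hypothesis kappa_gt0 : 0 < kappa.
Notation g := (@hyp_metric R n kappa).
Notation ht x := (x 0 (@ord_max n)).
Implicit Types (x z : 'rV[R]_n.+1) (i l : 'I_n.+1) (k : 'I_n.+1 -> nat).

Definition cell (w : R) (tau : 'I_n.+1 -> R) : set 'rV[R]_n.+1 :=
  rV_box (fun i => w * tau i) (fun i => w * (tau i + 1)).

(** The support of the bump of a cell lies in this box, which is larger than
    that support so as to be half-open like the cells. *)
Definition star (w : R) (tau : 'I_n.+1 -> R) : set 'rV[R]_n.+1 :=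
  rV_box (fun i => w * (tau i - 2^-1)) (fun i => w * (tau i + 2)).

Variables (H : nat -> R -> R) (c C : R).
Hypothesis dH : forall (k : nat) (t : R), is_derive t 1 (H k) (H k.+1 t).
Hypothesis c_gt0 : 0 < c.
Hypothesis C_ge0 : 0 <= C.
Hypothesis HC : forall (k : nat) t, (k <= 2)%N -> `|H k t| <= C.
Hypothesis H0 : forall (k : nat) t, ~~ (- 2^-1 <= t <= 3 / 2) -> H k t = 0.
Hypothesis Hc : forall t, 0 <= t <= 1 -> c <= H 0%N t.

Variables (w eps : R) (tau : 'I_n.+1 -> R).
Hypothesis w_gt0 : 0 < w.
Hypothesis eps_gt0 : 0 < eps.
Hypothesis eps_le1 : eps <= 1.
Hypothesis tau_max : tau ord_max = eps^-1.
Notation F := (cell_fun H w tau).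
Notation f := (F (fun=> 0%N)).

Lemma cell_fun_outside k z : ~ star w tau z -> F k z = 0.
Proof.
move=> /existsNP[i nz]; rewrite /cell_fun (bigD1 i)//= H0 ?mul0r//.
apply/negP => /andP[t1 t2]; apply: nz.
rewrite lerBrDl in t1; rewrite lerBlDr in t2.
rewrite ![w * _]mulrC -ler_pdivlMr// -ltr_pdivrMr//.
by apply/andP; split; lra.
Qed.

Lemma cell_fun_bounded k z : (forall l, k l <= 2)%N -> `|F k z| <= C ^+ n.+1.
Proof.
move=> k2; rewrite /cell_fun normr_prod.
rewrite -[n.+1 in leRHS]card_ord -prodr_const.
by apply: ler_prod => l _; rewrite normr_ge0 HC.
Qed.

Lemma cell_fun_ge z : cell w tau z -> c ^+ n.+1 <= f z.
Proof.
move=> zq; rewrite /cell_fun.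
rewrite -[n.+1 in leLHS]card_ord -prodr_const.
apply: ler_prod => l _; rewrite (ltW c_gt0) Hc//.
have /andP[h1 h2] := zq l.
rewrite mulrC -ler_pdivlMr// in h1; rewrite mulrC -ltr_pdivrMr// in h2.
by apply/andP; split; lra.
Qed.

Let e i : 'I_n.+1 -> nat := fun l => (l == i : nat).

Lemma partial_bump i x : partial i f x = w^-1 * F (e i) x.
Proof. by rewrite partial_cell_fun. Qed.

Lemma partial2_bump i l x : partial l (partial i f) x =
  w^-1 / w * F (fun m => (m == i) + (m == l))%N x.
Proof.
rewrite partial_cell_fun//.
by rewrite (partial_scale_cell_fun dH).
Qed.

Let P := C ^+ n.+1.
Let P_ge0 : 0 <= P. Proof. exact: exprn_ge0. Qed.

Lemma partial_bump_le i x : `|partial i f x| <= P / w.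
Proof.
rewrite partial_bump normrM gtr0_norm ?invr_gt0// mulrC ler_wpM2r ?invr_ge0 ?(ltW w_gt0)//.
by apply: cell_fun_bounded => l; rewrite /e; case: (_ == _).
Qed.

Lemma partial2_bump_le i l x : `|partial i (partial l f) x| <= P / w ^+ 2.
Proof.
rewrite partial2_bump -invfM -expr2 normrM gtr0_norm ?invr_gt0 ?exprn_gt0//.
rewrite mulrC ler_wpM2r ?invr_ge0 ?exprn_ge0 ?(ltW w_gt0)//.
by apply: cell_fun_bounded => m; case: (_ == _); case: (_ == _).
Qed.

Lemma star_height x : star w tau x -> ht x <= 3 * w / eps.
Proof.
move=> /(_ ord_max)/andP[_ /ltW/le_trans]; apply; rewrite tau_max.
rewrite [3 * w]mulrC -mulrA ler_wpM2l ?(ltW w_gt0)//.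
have e1 : 1 <= eps^-1 by rewrite invf_ge1.
by lra.
Qed.

Lemma cell_vanishes x : ~ star w tau x -> vanishes_at (jet_of g f) x.
Proof.
move=> xs.
have p1 i : partial i f x = 0 by rewrite partial_bump cell_fun_outside// mulr0.
have p2 i l : partial i (partial l f) x = 0.
  by rewrite partial2_bump cell_fun_outside// mulr0.
split; first exact: cell_fun_outside.
  by apply/rowP => i; rewrite /= hyp_grad// p1 mulr0 mxE.
apply/matrixP => i l; rewrite /= !mxE p2 sub0r big1 ?oppr0// => m _.
by rewrite p1 mulr0.
Qed.

Definition energy_const : R := (hess_const (n := n) + ricci_const (n := n)) * P ^+ 2.
Definition H2_bound : R := hess_const (n := n) * P ^+ 2 * (kappa ^+ 4 / eps ^+ 4) +
  n.+1%:R * (kappa * (3 * P / eps)) ^+ 2 + P ^+ 2.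

Lemma cell_energy_le x : half_space x ->
  `|energy g (jet_of g f) x| <= energy_const * (kappa ^+ 4 / eps ^+ 4).
Proof.
move=> xS; have [xs|xs] := pselect (star w tau x); last first.
  have [_ v2 v3] := cell_vanishes xs.
  rewrite /energy v2 v3 /tensor_inner /bilin !trmx0 !mulmx0 mxtrace0 mxE addr0 normr0.
  have k4 : 0 <= kappa ^+ 4 / eps ^+ 4 by rewrite divr_ge0 ?exprn_ge0 ?ltW.
  by rewrite mulr_ge0// mulr_ge0 ?sqr_ge0// addr_ge0 ?hess_const_ge0 ?ricci_const_ge0.
have xh := star_height xs.
rewrite /energy (le_trans (ler_normD _ _))// /energy_const !mulrDl lerD//.
  rewrite ger0_norm ?tensor_inner_ge0//.
  apply: (tensor_inner_hess_le kappa_gt0 xS w_gt0 eps_gt0 eps_le1 P_ge0 xh).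
    by move=> i; exact: partial_bump_le.
  by move=> i l; exact: partial2_bump_le.
apply: (ricci_grad_le kappa_gt0 xS w_gt0 eps_gt0 eps_le1 P_ge0 xh).
by move=> i; exact: partial_bump_le.
Qed.

Lemma cell_H2_density_le x : half_space x ->
  f x ^+ 2 <= H2_density g (jet_of g f) x <= H2_bound.
Proof.
move=> xS; have [xs|xs] := pselect (star w tau x); last first.
  have [v1 v2 v3] := cell_vanishes xs; rewrite /= in v1.
  rewrite /H2_density v2 v3 /= v1 /tensor_inner /bilin !trmx0 !mulmx0 mxtrace0 mxE.
  rewrite expr0n/= !addr0 lexx/=.
  have k4 : 0 <= kappa ^+ 4 / eps ^+ 4 by rewrite divr_ge0 ?exprn_ge0 ?ltW.
  rewrite /H2_bound addr_ge0 ?sqr_ge0// addr_ge0//.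
    by rewrite mulr_ge0// mulr_ge0 ?sqr_ge0// hess_const_ge0.
  by rewrite mulr_ge0 ?sqr_ge0.
have xh := star_height xs.
have p1 i : `|partial i f x| <= P / w by exact: partial_bump_le.
have p2 i l : `|partial i (partial l f) x| <= P / w ^+ 2 by exact: partial2_bump_le.
have /andP[G0 G1] := metric_grad_le kappa_gt0 xS w_gt0 P_ge0 xh p1.
have T0 := tensor_inner_ge0 kappa_gt0 xS (hess g f x).
have T1 := tensor_inner_hess_le kappa_gt0 xS w_gt0 eps_gt0 eps_le1 P_ge0 xh p1 p2.
rewrite /H2_density lerDr addr_ge0//= /H2_bound.
rewrite lerD//; first exact: lerD.
rewrite -real_normK ?num_real// ler_pXn2r// ?nnegrE//.
by rewrite cell_fun_bounded.
Qed.

Variable D : set 'rV[R]_n.+1.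
Hypothesis oD : open D.
Hypothesis DS : D `<=` half_space.

Let mD : measurable D. Proof. exact: open_measurable_rV. Qed.

Let mF k : measurable_fun D (F k).
Proof.
apply: continuous_measurable_rV => // x _.
by apply: differentiable_continuous; exact: cell_fun_differentiable.
Qed.

Let mht : measurable_fun D (fun x => ht x).
Proof. by apply: continuous_measurable_rV => // x _; exact: coord_continuous. Qed.

Let mhtV : measurable_fun D (fun x => (ht x)^-1).
Proof.
apply: continuous_measurable_rV => // x Dx.
have y_neq0 : ht x != 0 by rewrite gt_eqF//; exact: DS.
by apply: (@continuousV _ _ (fun z : 'rV[R]_n.+1 => ht z)) => //; exact: coord_continuous.
Qed.

Let mp1 i : measurable_fun D (partial i f).
Proof. by rewrite partial_cell_fun//; apply: measurable_funM. Qed.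

Let mp2 i l : measurable_fun D (partial i (partial l f)).
Proof.
by rewrite partial_cell_fun// (partial_scale_cell_fun dH); apply: measurable_funM.
Qed.

Let mgrad i : measurable_fun D (fun x => grad g f x 0 i).
Proof.
apply: (@eq_measurable_fun _ _ _ _ _ (fun x => (kappa * ht x) ^+ 2 * partial i f x)).
  by move=> x _; rewrite hyp_grad.
by apply: measurable_funM => //; apply: measurable_funX; apply: measurable_funM.
Qed.

Let mhess i l : measurable_fun D (fun x => hess g f x i l).
Proof.
apply: (@eq_measurable_fun _ _ _ _ _ (fun x => partial i (partial l f) x -
  (\sum_m hyp_gamma m i l * partial m f x) * (ht x)^-1)).
  by move=> x /[!inE] Dx; rewrite hyp_hess//; exact: DS.
apply: measurable_funB => //; apply: measurable_funM => //.
by apply: measurable_sum => m; apply: measurable_funM.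
Qed.

Lemma cell_jet_measurable : jet_measurable D (jet_of g f).
Proof. split=> [|i|i l]; [exact: mF|exact: mgrad|exact: mhess]. Qed.

Let mtensor : measurable_fun D (fun x => tensor_inner g x (hess g f x) (hess g f x)).
Proof.
apply: (@eq_measurable_fun _ _ _ _ _ (fun x => (kappa * ht x) ^+ 4 *
  \sum_i \sum_l hess g f x i l ^+ 2)).
  by move=> x _; rewrite tensor_inner_hyp.
apply: measurable_funM; first by apply: measurable_funX; apply: measurable_funM.
by apply: measurable_sum => i; apply: measurable_sum => l; apply: measurable_funX.
Qed.

Lemma cell_energy_measurable : measurable_fun D (energy g (jet_of g f)).
Proof.
apply: measurable_funD => //=.
apply: (@eq_measurable_fun _ _ _ _ _ (fun x => \sum_i \sum_l
  hyp_ricci i l * ((ht x)^-1 * (ht x)^-1) * grad g f x 0 i * grad g f x 0 l)).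
  move=> x /[!inE] Dx; rewrite bilin_sum; apply: eq_bigr => i _.
  by apply: eq_bigr => l _; rewrite hyp_ricciE ?expr2 ?invfM//; exact: DS.
apply: measurable_sum => i; apply: measurable_sum => l.
by do 2 (apply: measurable_funM => //); apply: measurable_funM => //; apply: measurable_funM.
Qed.

Lemma cell_H2_density_measurable : measurable_fun D (H2_density g (jet_of g f)).
Proof.
apply: measurable_funD; last by apply: measurable_funX; exact: mF.
apply: measurable_funD => //=.
apply: (@eq_measurable_fun _ _ _ _ _ (fun x => \sum_i
  (kappa^-1 * (ht x)^-1) ^+ 2 * grad g f x 0 i ^+ 2)).
  move=> x _; rewrite /hyp_metric scalar_bilin mulr_sumr; apply: eq_bigr => i _.
  by rewrite -invfM exprVn expr2.
apply: measurable_sum => i; apply: measurable_funM; last exact: measurable_funX.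
by apply: measurable_funX; apply: measurable_funM.
Qed.

End cell_jets.

(** * Selection of cells *)

Section selection.
Context {R : realType}.

(** The pigeonhole argument of the grid: [a i] and [b i] are the volumes
    in the cell and in the star of [i]. Averaging over the colours gives one whose
    cells carry [V / #|C|]; those of its cells with [b i > 2 #|C| a i] carry at
    most half of it, since its stars carry at most [V]. *)
Lemma select_same_colour (I C : finType) (col : I -> C) (a b : I -> R) (V mu : R) (j : nat) :
  0 < V -> 0 < mu -> (forall i, 0 <= a i <= mu) -> (forall i, 0 <= b i) ->
  V <= \sum_i a i ->
  (forall c, \sum_(i | col i == c) b i <= V) ->
  j%:R * mu <= V / (2 * #|C|%:R) ->
  exists e : 'I_j -> I, [/\ injective e, forall k l, col (e k) = col (e l) &
    forall k, 0 < a (e k) /\ b (e k) <= 2 * #|C|%:R * a (e k)].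
Proof.
move=> V0 mu0 amu b0 Va bV jmu; set N : R := #|C|%:R.
have N0 : 0 < N.
  rewrite ltr0n lt0n; apply/eqP => C0; move: V0; rewrite ltNge => /negP[].
  apply: le_trans Va _; rewrite big1// => i _.
  by have := card0_eq C0 (col i); rewrite !inE.
have [c hc] : exists c, V / N <= \sum_(i | col i == c) a i.
  apply/not_existsP => nc.
  suff : \sum_i a i < V by rewrite ltNge Va.
  rewrite (partition_big col xpredT)//=.
  have -> : V = \sum_(c : C) (V / N).
    by rewrite sumr_const -[RHS]mulr_natr mulfVK// gt_eqF.
  apply: ltr_sum => [|c _].
    have /card_gt0P[c0 _] : (0 < #|C|)%N by rewrite -(ltr0n R).
    by apply/hasP; exists c0; rewrite ?mem_index_enum.
  by rewrite ltNge; apply/negP/nc.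
pose good := [pred i | [&& col i == c, 0 < a i & b i <= 2 * N * a i]].
have good_mass : V / (2 * N) <= \sum_(i in good) a i.
  have h : \sum_(i | col i == c) a i <= \sum_(i in good) a i + V / (2 * N).
    rewrite (bigID (fun i => i \in good))/= lerD//.
      rewrite le_eqVlt; apply/orP; left; apply/eqP; apply: eq_bigl => i.
      have -> : (i \in good) = [&& col i == c, 0 < a i & b i <= 2 * N * a i] by rewrite inE.
      by rewrite andbA andbb.
    apply: (@le_trans _ _ (\sum_(i | col i == c) (2 * N)^-1 * b i)).
      rewrite big_mkcondr/= ler_sum// => i ci; rewrite inE ci/=.
      have Nb : 0 <= (2 * N)^-1 * b i.
        by rewrite mulr_ge0// invr_ge0 mulr_ge0// ltW.
      case: ifPn => //; rewrite negb_and -leNgt -ltNge => /orP[ai|ai].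
        by rewrite (le_trans ai).
      by rewrite ler_pdivlMl ?mulr_gt0// ltW.
    by rewrite -mulr_sumr mulrC ler_wpM2r ?bV// invr_ge0 mulr_ge0// ltW.
  have -> : V / (2 * N) = V / N - V / (2 * N) by field; rewrite gt_eqF.
  by rewrite lerBlDr; exact: le_trans hc h.
have jgood : (j <= #|good|)%N.
  rewrite -(ler_nat R) -(ler_pM2r mu0) (le_trans jmu)// (le_trans good_mass)//.
  rewrite mulr_natl -sumr_const ler_sum// => i _.
  by have /andP[] := amu i.
pose e (k : 'I_j) : I := enum_val (widen_ord jgood k).
have eP k : e k \in good by exact: enum_valP.
exists e; split.
- by move=> k l /enum_val_inj /(congr1 val) /= /val_inj.
- by move=> k l; have := eP k; have := eP l; rewrite !inE => /and3P[/eqP-> _ _] /and3P[/eqP-> _ _].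
- by move=> k; have := eP k; rewrite inE => /and3P[].
Qed.

Lemma locate_step (u : nat -> R) (x : R) (N : nat) : u 0%N <= x -> x < u N ->
  exists2 m, (m < N)%N & u m <= x < u m.+1.
Proof.
move=> u0; elim: N => [|N IH] xN; first by move: xN; rewrite ltNge u0.
have [/IH[m mN hm]|uN] := ltP x (u N); first by exists m => //; exact: ltnW.
by exists N => //; rewrite uN.
Qed.

End selection.

(** * The hyperbolic grid *)

Section grid.
Context {R : realType} {n : nat}.
Notation ht x := (x 0 (@ord_max n)).
Variables (a b eps : R) (N : nat).
Hypothesis a_gt0 : 0 < a.
Hypothesis b_gt0 : 0 < b.
Hypothesis eps_gt0 : 0 < eps.
Hypothesis eps_le1 : eps <= 1.
Hypothesis N_large : 2 * b / (a * eps) < N%:R.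
Local Notation idx := {ffun 'I_n.+1 -> 'I_N}.
Implicit Types (p q : idx) (x : 'rV[R]_n.+1).

Definition layer_height (m : nat) : R := a * (1 + eps) ^+ m.
Definition grid_width p : R := layer_height (p ord_max) * eps.
(** In the vertical direction the layer itself fixes the position of a cell,
    since [layer_height = width / eps]; the horizontal indices are counted
    from [- b], so that all of them are natural numbers. *)
Definition grid_shift p (i : 'I_n.+1) : R :=
  if i == ord_max then eps^-1 else (p i)%:R - b / grid_width p.
Definition grid_colour p : {ffun 'I_n.+1 -> 'I_3} :=
  [ffun i => Ordinal (ltn_pmod (p i) (isT : 0 < 3)%N)].

Let eps1_ge1 : 1 <= 1 + eps. Proof. by rewrite lerDl ltW. Qed.

Lemma layer_height_ge m : a <= layer_height m.
Proof. by rewrite /layer_height ler_peMr ?(ltW a_gt0)// exprn_ege1. Qed.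

Lemma layer_height_gt0 m : 0 < layer_height m.
Proof. exact: lt_le_trans (layer_height_ge m). Qed.

Lemma grid_width_gt0 p : 0 < grid_width p.
Proof. by rewrite mulr_gt0// layer_height_gt0. Qed.

Lemma grid_shift_max p : grid_shift p ord_max = eps^-1.
Proof. by rewrite /grid_shift eqxx. Qed.

Let width_div p : grid_width p * eps^-1 = layer_height (p ord_max).
Proof. by rewrite /grid_width mulfK// gt_eqF. Qed.

Lemma cell_height p x : cell (grid_width p) (grid_shift p) x ->
  layer_height (p ord_max) <= ht x.
Proof. by move=> /(_ ord_max)/andP[+ _]; rewrite grid_shift_max width_div. Qed.

(** The indices stay below [N] since [(1 + eps)^N >= N eps] and since cells
    have side at least [a eps]. *)
Lemma grid_cover x : a <= ht x -> (forall i, `|x 0 i| <= b) ->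
  exists p, cell (grid_width p) (grid_shift p) x.
Proof.
move=> ax xb.
have N0 : b / (a * eps) < N%:R.
  apply: le_lt_trans N_large; rewrite -mulrA ler_peMl// ?ler1n//.
  by rewrite divr_ge0 ?mulr_ge0 ?ltW.
have [] := @locate_step _ layer_height (ht x) N.
- by rewrite /layer_height expr0 mulr1.
- apply: (@le_lt_trans _ _ b); first by rewrite (le_trans (ler_norm _)).
  have bern : N%:R * eps <= (1 + eps) ^+ N.
    elim: (N) => [|k IH]; first by rewrite mul0r expr0.
    have k1 : 1 <= (1 + eps) ^+ k by rewrite exprn_ege1.
    rewrite exprS mulrDl mul1r -natr1 mulrDl mul1r lerD// ler_peMr// ltW//.
  rewrite /layer_height mulrC -ltr_pdivrMr//; apply: lt_le_trans bern.
  by rewrite -ltr_pdivrMr// -mulrA -invfM.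
move=> m mN /andP[m1 m2].
pose w := layer_height m * eps.
have w0 : 0 < w by rewrite mulr_gt0// layer_height_gt0.
have wae : a * eps <= w by rewrite /w ler_wpM2r ?(ltW eps_gt0)// layer_height_ge.
have hk i : exists k : 'I_N, w * (k%:R - b / w) <= x 0 i < w * (k%:R - b / w + 1).
  have [] := @locate_step _ (fun k => w * (k%:R - b / w)) (x 0 i) N.
  - rewrite mulrBr mulr0 sub0r mulrC divfK ?gt_eqF//.
    by have := xb i; rewrite ler_norml => /andP[].
  - apply: (@le_lt_trans _ _ b); first by rewrite (le_trans (ler_norm _)).
    rewrite mulrBr [w * (b / w)]mulrC divfK ?gt_eqF// ltrBrDl.
    rewrite mulrC -ltr_pdivrMr//; apply: le_lt_trans N_large.
    rewrite (_ : b + b = 2 * b); last by ring.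
    by rewrite ler_wpM2l ?mulr_ge0 ?(ltW b_gt0)// lef_pV2 ?posrE// mulr_gt0.
  move=> k kN hk; exists (Ordinal kN); move: hk => /=.
  by rewrite -natr1 (_ : k%:R + 1 - b / w = k%:R - b / w + 1)//; ring.
have /choice[k kP] := hk.
exists [ffun i => if i == ord_max then Ordinal mN else k i].
have E : grid_width [ffun i => if i == ord_max then Ordinal mN else k i] = w.
  by rewrite /grid_width ffunE eqxx.
move=> i; rewrite E /grid_shift E; case: eqVneq => [->|imax].
  rewrite mulrDr mulr1 {1 2}/w mulfK ?gt_eqF// m1/=.
  by move: m2; rewrite /layer_height exprSr mulrA mulrDr mulr1.
by rewrite ffunE (negbTE imax).
Qed.

Lemma star_height_bounds p x : star (grid_width p) (grid_shift p) x ->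
  layer_height (p ord_max) * (1 - eps / 2) <= ht x <
  layer_height (p ord_max) * (1 + 2 * eps).
Proof.
move=> /(_ ord_max)/andP[]; rewrite grid_shift_max mulrBr mulrDr width_div.
rewrite /grid_width => h1 h2; apply/andP; split.
  by apply: le_trans h1; rewrite le_eqVlt; apply/orP; left; apply/eqP; ring.
by apply: lt_le_trans h2 _; rewrite le_eqVlt; apply/orP; left; apply/eqP; ring.
Qed.

Lemma colour_gap p q i : grid_colour p = grid_colour q -> (p i < q i)%N ->
  (p i + 3 <= q i)%N.
Proof.
move=> /ffunP/(_ i); rewrite !ffunE => -[/eqP]; rewrite eq_sym => pq ltpq.
rewrite -leq_subRL ?(ltnW ltpq)//; apply: dvdn_leq; first by rewrite subn_gt0.
by rewrite -(eqn_mod_dvd _ (ltnW ltpq)).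
Qed.

(** Layers of the same colour differ by at least 3 indices, and
    [(1 + eps)^3 (1 - eps / 2) > 1 + 2 eps]: the bottom of the higher star is above
    the top of the lower one. *)
Lemma star_layer_disjoint p q x : grid_colour p = grid_colour q ->
  star (grid_width p) (grid_shift p) x -> star (grid_width q) (grid_shift q) x ->
  ~ (p ord_max < q ord_max)%N.
Proof.
move=> pq /star_height_bounds/andP[_ hp] /star_height_bounds/andP[hq _] /(colour_gap pq) gap.
have := le_lt_trans hq hp; apply/negP; rewrite -leNgt.
have le3 : layer_height (p ord_max) * (1 + eps) ^+ 3 <= layer_height (q ord_max).
  rewrite /layer_height -mulrA -exprD ler_wpM2l ?(ltW a_gt0)//.
  by rewrite ler_weXn2l.
have e2 : 0 <= 1 - eps / 2.
  by rewrite subr_ge0 ler_pdivrMr// mul1r (le_trans eps_le1)// ler1n.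
apply: le_trans (ler_wpM2r e2 le3); rewrite -[leRHS]mulrA.
rewrite ler_wpM2l ?(ltW (layer_height_gt0 _))// -subr_ge0.
rewrite (_ : _ - _ = eps / 2 * ((1 - eps ^+ 3) + eps * (3 - eps))); last by field.
have e3 : eps ^+ 3 <= 1 by rewrite exprn_ile1// ltW.
have e3' : 0 <= 3 - eps by rewrite subr_ge0 (le_trans eps_le1)// ler1n.
by rewrite mulr_ge0 ?divr_ge0 ?(ltW eps_gt0)// addr_ge0 ?subr_ge0// mulr_ge0// ltW.
Qed.

(** In a common layer, horizontal indices of the same colour differ by at least
    3 while stars have width 5/2. *)
Lemma star_disjoint p q x : grid_colour p = grid_colour q ->
  star (grid_width p) (grid_shift p) x -> star (grid_width q) (grid_shift q) x ->
  p = q.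
Proof.
move=> pq xp xq.
have pqm : p ord_max = q ord_max.
  apply: ord_inj; case: (ltngtP (p ord_max) (q ord_max)) => // lt_pq.
    by case: (star_layer_disjoint pq xp xq lt_pq).
  by case: (star_layer_disjoint (esym pq) xq xp lt_pq).
have wpq : grid_width p = grid_width q by rewrite /grid_width pqm.
have noless (r s : idx) i : grid_colour r = grid_colour s -> i != ord_max ->
    grid_width r = grid_width s ->
    star (grid_width r) (grid_shift r) x -> star (grid_width s) (grid_shift s) x ->
    ~ (r i < s i)%N.
  move=> rs imax wrs /(_ i)/andP[_ h1] /(_ i)/andP[h2 _] /(colour_gap rs) gap.
  have := le_lt_trans h2 h1; rewrite wrs ltr_pM2l ?grid_width_gt0//.
  rewrite /grid_shift (negbTE imax) wrs.
  have : (r i)%:R + 3 <= (s i)%:R :> R by rewrite -natrD ler_nat.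
  set u : R := (r i)%:R; set v : R := (s i)%:R; set t := b / _; lra.
apply/ffunP => i; have [->//|imax] := eqVneq i ord_max.
apply: ord_inj; case: (ltngtP (p i) (q i)) => // lt_pq.
  by case: (noless p q i pq imax wpq xp xq lt_pq).
by case: (noless q p i (esym pq) imax (esym wpq) xq xp lt_pq).
Qed.

End grid.

(** * Volumes of cells *)

Section volumes.
Context {R : realType} {n : nat}.
Variable kappa : R.
Hypothesis kappa_gt0 : 0 < kappa.
Notation g := (@hyp_metric R n kappa).
Notation ht x := (x 0 (@ord_max n)).
Notation mu := (@lebesgue_rV R n.+1).
Variables (D : set 'rV[R]_n.+1) (a b : R).
Hypothesis oD : open D.
Hypothesis D0 : D !=set0.
Hypothesis a_gt0 : 0 < a.
Hypothesis b_gt0 : 0 < b.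
Hypothesis Da : forall x, D x -> a <= ht x.
Hypothesis Db : forall x, D x -> forall i, `|x 0 i| <= b.

Let mD : measurable D. Proof. exact: open_measurable_rV. Qed.
Let DS : D `<=` half_space.
Proof. by move=> x /Da; exact: lt_le_trans. Qed.

Lemma lebesgue_bounded_lty : (mu D < +oo)%E.
Proof.
apply: (@le_lt_trans _ _ (mu (rV_box (fun=> - b) (fun=> b + 1)))).
  apply: le_measure; rewrite ?inE//; first exact: measurable_rV_box.
  move=> x Dx i; have := Db Dx i; rewrite ler_norml => /andP[-> h2]/=.
  by rewrite (le_lt_trans h2)// ltrDl.
rewrite lebesgue_rV_box ?ltry// => _.
by rewrite (@le_trans _ _ 0) ?oppr_le0 ?addr_ge0 ?(ltW b_gt0).
Qed.

Lemma vol_densityE x : D x -> vol_density g x = (kappa * ht x) ^- n.+1.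
Proof. by move=> Dx; rewrite /vol_density hyp_metric_vol//; exact: DS. Qed.

Lemma vol_density_le x s : D x -> 0 < s -> s <= ht x ->
  vol_density g x <= (kappa * s) ^- n.+1.
Proof.
move=> Dx s0 sx; rewrite vol_densityE//.
have ks : 0 < kappa * s by rewrite mulr_gt0.
have kx : 0 < kappa * ht x by rewrite mulr_gt0//; exact: lt_le_trans sx.
rewrite lef_pV2 ?posrE ?exprn_gt0//.
by rewrite ler_pXn2r ?nnegrE ?(ltW ks) ?(ltW kx)// ler_pM2l.
Qed.

Lemma vol_density_measurable : measurable_fun D (vol_density g).
Proof.
apply: (@eq_measurable_fun _ _ _ _ _ (fun x : 'rV[R]_n.+1 => ((kappa * ht x) ^-1) ^+ n.+1)).
  by move=> x /[!inE] Dx; rewrite vol_densityE// exprVn.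
apply: measurable_funX; apply: continuous_measurable_rV => // x Dx.
have ky : kappa * ht x != 0 by rewrite mulf_neq0 ?gt_eqF//; exact: DS.
apply: (@continuousV _ _ (fun z : 'rV[R]_n.+1 => kappa * ht z)) => //.
apply: (@continuousM _ _ (cst kappa) (fun z : 'rV[R]_n.+1 => ht z)).
  exact: cst_continuous.
exact: coord_continuous.
Qed.

Lemma vol_density_integrable : mu.-integrable D (EFin \o vol_density g).
Proof.
apply: measurable_bounded_integrable => //.
- exact: lebesgue_bounded_lty.
- exact: vol_density_measurable.
exists ((kappa * a) ^- n.+1); split; first exact: num_real.
move=> M hM x Dx /=; rewrite ger0_norm ?sqrtr_ge0//.
by rewrite (le_trans (vol_density_le Dx a_gt0 (Da Dx)))// ltW.
Qed.

Lemma fine_riem_volume : fine (riem_volume g D) = \int[mu]_(x in D) vol_density g x.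
Proof.
rewrite /riem_volume fine_vol_integral; apply: eq_Rintegral => x _.
by rewrite mul1r.
Qed.

Lemma riem_volume_gt0 : 0 < fine (riem_volume g D).
Proof.
rewrite fine_riem_volume.
have kb : 0 < (kappa * b) ^- n.+1 by rewrite invr_gt0 exprn_gt0// mulr_gt0.
have cst_int : mu.-integrable D (EFin \o (cst ((kappa * b) ^- n.+1))).
  apply: measurable_bounded_integrable => //; first exact: lebesgue_bounded_lty.
  exists ((kappa * b) ^- n.+1); split; first exact: num_real.
  by move=> M hM x Dx; rewrite /= gtr0_norm// ltW.
apply: (@lt_le_trans _ _ (\int[mu]_(x in D) (kappa * b) ^- n.+1)).
  rewrite Rintegral_cst// mulr_gt0// fine_gt0// lebesgue_bounded_lty andbT.
  exact: lebesgue_rV_open_gt0.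
apply: le_Rintegral => //; first exact: vol_density_integrable.
move=> x Dx; rewrite vol_densityE//.
have y0 : 0 < ht x by exact: DS.
rewrite lef_pV2 ?posrE ?exprn_gt0 ?mulr_gt0//.
rewrite ler_pXn2r ?nnegrE ?(ltW (mulr_gt0 _ _))// ler_pM2l//.
by rewrite (le_trans (ler_norm _)) ?Db.
Qed.

(** The volume of [A] in [D], written as an integral over [D] so that sums over
    cells compare pointwise under the integral. *)
Definition rel_vol (A : set 'rV[R]_n.+1) : R :=
  \int[mu]_(x in D) (\1_A x * vol_density g x).

Lemma indic_vol_integrable A : measurable A ->
  mu.-integrable D (EFin \o (fun x => \1_A x * vol_density g x)).
Proof.
move=> mA; apply: (bounded_mul_integrable mD vol_density_integrable (M := 1)).
- by move=> x; exact: sqrtr_ge0.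
- exact: measurable_indic.
- by move=> x Dx; rewrite ger0_norm// indicE; case: (_ \in _).
Qed.

Lemma rel_vol_ge0 A : 0 <= rel_vol A.
Proof. by apply: Rintegral_ge0 => x Dx; rewrite mulr_ge0// sqrtr_ge0. Qed.

(** The volume density is at most [(kappa s)^-d] on the cell, whose Lebesgue
    measure is [(s eps)^d]. *)
Lemma rel_vol_cell_le eps s w (tau : 'I_n.+1 -> R) : 0 < s -> w = s * eps -> 0 < eps ->
  (forall x, cell w tau x -> s <= ht x) ->
  rel_vol (cell w tau) <= (eps / kappa) ^+ n.+1.
Proof.
move=> s0 wE eps0 hs; set A := cell w tau.
have mA : measurable A by exact: measurable_rV_box.
have w0 : 0 < w by rewrite wE mulr_gt0.
have ks : 0 < (kappa * s) ^- n.+1 by rewrite invr_gt0 exprn_gt0// mulr_gt0.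
have muA : mu A = (w ^+ n.+1)%:E.
  rewrite /A /cell lebesgue_rV_box => [|i]; last by rewrite ler_pM2l// lerDl.
  congr EFin; rewrite -[n.+1 in RHS]card_ord -prodr_const; apply: eq_bigr => i _.
  by rewrite mulrDr mulr1 addrAC subrr add0r.
have muDA : (mu (A `&` D) <= (w ^+ n.+1)%:E)%E.
  by rewrite -muA; apply: le_measure; rewrite ?inE//; exact: measurableI.
suff : ((rel_vol A)%:E <= ((eps / kappa) ^+ n.+1)%:E)%E by rewrite lee_fin.
rewrite /rel_vol /Rintegral fineK; last first.
  by apply: integrable_fin_num => //; exact: indic_vol_integrable.
apply: (@le_trans _ _ (\int[mu]_(x in D) (((kappa * s) ^- n.+1)%:E * (\1_A x)%:E))%E).
  apply: ge0_le_integral => //.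
  - by move=> x Dx; rewrite lee_fin mulr_ge0// sqrtr_ge0.
  - by have /measurable_int := indic_vol_integrable mA.
  - apply/measurable_EFinP; apply: measurable_funM => //; exact: measurable_indic.
  - move=> x Dx; rewrite -EFinM lee_fin indicE.
    have [xA|xA] := pselect (A x); last by rewrite memNset// mul0r mulr0.
    by rewrite mem_set// mul1r mulr1 vol_density_le//; exact: hs.
rewrite ge0_integralZl_EFin//; [|exact/measurable_EFinP/measurable_indic|exact: ltW].
rewrite integral_indic//.
apply: le_trans (lee_pmul _ _ (lexx _) muDA) _ => //; first by rewrite lee_fin ltW.
rewrite -EFinM lee_fin wE -exprVn -exprMn le_eqVlt; apply/orP; left; apply/eqP.
by congr (_ ^+ _); field; rewrite !gt_eqF.
Qed.

End volumes.

(** * Eigenvalue bounds *)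

Section eigenvalue_bound.
Context {R : realType} {n : nat}.
Notation mu := (@lebesgue_rV R n.+1).
Notation colours := {ffun 'I_n.+1 -> 'I_3}.
Variables (H : nat -> R -> R) (c C : R).
Hypothesis dH : forall (k : nat) (t : R), is_derive t 1 (H k) (H k.+1 t).
Hypothesis c_gt0 : 0 < c.
Hypothesis C_ge0 : 0 <= C.
Hypothesis HC : forall (k : nat) t, (k <= 2)%N -> `|H k t| <= C.
Hypothesis H0 : forall (k : nat) t, ~~ (- 2^-1 <= t <= 3 / 2) -> H k t = 0.
Hypothesis Hc : forall t, 0 <= t <= 1 -> c <= H 0%N t.

Variables (kappa : R) (D : set 'rV[R]_n.+1).
Hypothesis kappa_gt0 : 0 < kappa.
Hypothesis DS : D `<=` half_space.
Hypothesis oD : open D.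
Hypothesis D0 : D !=set0.
Hypothesis bD : riem_bounded half_space (hyp_metric kappa) D.
Notation g := (@hyp_metric R n kappa).

Definition rayleigh_const : R :=
  energy_const (n := n) C * (2 * #|colours|%:R) / (c ^+ n.+1) ^+ 2.

Lemma rayleigh_const_ge0 : 0 <= rayleigh_const.
Proof.
rewrite divr_ge0 ?sqr_ge0// mulr_ge0// mulr_ge0 ?sqr_ge0// addr_ge0//.
  exact: hess_const_ge0.
exact: ricci_const_ge0.
Qed.

(** The hypothesis on the volume of [D] says that [j] times the bound on the
    volume of a cell fits into what the selected colour carries. *)
Lemma neumann_le_at_scale (eps : R) (j : nat) : 0 < eps -> eps <= 1 -> (0 < j)%N ->
  j%:R * (eps / kappa) ^+ n.+1 <= fine (riem_volume g D) / (2 * #|colours|%:R) ->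
  (biharmonic_neumann g D j <= (rayleigh_const * (kappa ^+ 4 / eps ^+ 4))%:E)%E.
Proof.
move=> eps0 eps1 j0 jV.
have [a [b [a0 b0 ab]]] := riem_bounded_coordinates kappa_gt0 bD.
have Da x : D x -> a <= x 0 ord_max by case/ab.
have Db x : D x -> forall i, `|x 0 i| <= b by case/ab.
have mD : measurable D by exact: open_measurable_rV.
have V0 := riem_volume_gt0 kappa_gt0 oD D0 a0 b0 Da Db.
have ivol := vol_density_integrable kappa_gt0 oD a0 b0 Da Db.
have iA := indic_vol_integrable kappa_gt0 oD a0 b0 Da Db.
(* The number of indices in each direction that [grid_cover] asks for. *)
pose N := (Num.truncn (2 * b / (a * eps))).+1.
have N_large : 2 * b / (a * eps) < N%:R.
  by have /andP[] := truncn_itv (ltW (divr_gt0 (mulr_gt0 (ltr0Sn R 1) b0) (mulr_gt0 a0 eps0))).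
pose W (p : {ffun 'I_n.+1 -> 'I_N}) := grid_width a eps p.
pose T (p : {ffun 'I_n.+1 -> 'I_N}) := grid_shift a b eps p.
pose A p := star (W p) (T p).
have mA p : measurable (A p) by exact: measurable_rV_box.
have W0 p : 0 < W p by exact: grid_width_gt0.
have Tmax p : T p ord_max = eps^-1 by exact: grid_shift_max.
have v0 x : 0 <= vol_density g x by exact: sqrtr_ge0.
have [] := @select_same_colour R _ _ (@grid_colour n N)
  (fun p => rel_vol kappa D (cell (W p) (T p))) (fun p => rel_vol kappa D (A p))
  (fine (riem_volume g D)) ((eps / kappa) ^+ n.+1) j => //.
- by rewrite exprn_gt0// divr_gt0.
- move=> p; rewrite rel_vol_ge0/=.
  apply: (rel_vol_cell_le kappa_gt0 oD a0 b0 Da Db (s := layer_height a eps (p ord_max))) => //.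
    exact: layer_height_gt0.
  by move=> x; apply: cell_height.
- by move=> p; exact: rel_vol_ge0.
- have [iS ES] := Rintegral_sum mD (fun p => iA _ (measurable_rV_box
    (fun i => W p * T p i) (fun i => W p * (T p i + 1)))).
  rewrite fine_riem_volume -ES; apply: le_Rintegral => // x Dx.
  have [p xp] := grid_cover a0 b0 eps0 N_large (Da x Dx) (Db x Dx).
  rewrite (bigD1 p)//= indicE mem_set// mul1r lerDl sumr_ge0// => q _.
  by rewrite mulr_ge0.
- move=> col.
  have iAc (p : {ffun 'I_n.+1 -> 'I_N}) : mu.-integrable D
      (EFin \o (fun x => (grid_colour p == col)%:R * (\1_(A p) x * vol_density g x))).
    by have := integrableZl mD (grid_colour p == col)%:R (iA _ (mA p)).
  have [iS ES] := Rintegral_sum mD iAc.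
  have -> : \sum_(p : {ffun 'I_n.+1 -> 'I_N} | grid_colour p == col) rel_vol kappa D (A p) =
      \int[mu]_(x in D) (\sum_p (grid_colour p == col)%:R * (\1_(A p) x * vol_density g x)).
    rewrite ES big_mkcond; apply: eq_bigr => p _.
    rewrite RintegralZl//; last exact: iA.
    by case: (_ == _); rewrite ?mul1r ?mul0r.
  rewrite fine_riem_volume; apply: le_Rintegral => // x Dx.
  have [[p [pc xp]]|nop] := pselect (exists p, grid_colour p = col /\ A p x).
    rewrite (bigD1 p)//= big1 ?addr0 => [|q qp].
      by rewrite pc eqxx mul1r indicE mem_set// mul1r.
    have [qc|] := eqVneq (grid_colour q) col; last by rewrite mul0r.
    rewrite mul1r indicE memNset ?mul0r// => xq.
    by move/eqP : qp; apply; apply: (star_disjoint a0 eps0 eps1 _ xq xp); rewrite qc.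
  rewrite big1// => q _.
  have [qc|] := eqVneq (grid_colour q) col; last by rewrite mul0r.
  by rewrite mul1r indicE memNset ?mul0r// => xq; apply: nop; exists q.
move=> e [e_inj ecol eM].
pose f k := cell_fun H (W (e k)) (T (e k)) (fun=> 0%N).
pose K := energy_const (n := n) C * (kappa ^+ 4 / eps ^+ 4).
pose M := Num.max K (H2_bound (n := n) kappa C eps).
have cd0 : 0 < c ^+ n.+1 by rewrite exprn_gt0.
have Kk k x : D x -> `|energy g (jet_of g (f k)) x| <= K.
  by move=> /DS; exact: cell_energy_le.
have Nk k x : D x -> f k x ^+ 2 <= H2_density g (jet_of g (f k)) x <= M.
  move=> /DS /(cell_H2_density_le kappa_gt0 dH C_ge0 HC H0 (W0 (e k)) eps0 eps1 (Tmax (e k))).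
  by move=> /andP[-> /le_trans]; apply; rewrite le_max lexx orbT.
have mJ k := cell_jet_measurable kappa_gt0 dH (W (e k)) (T (e k)) oD DS.
(* The bump is at least [c^d] on its cell. *)
have mass_f k : (c ^+ n.+1) ^+ 2 * rel_vol kappa D (cell (W (e k)) (T (e k))) <=
    \int[mu]_(x in D) (f k x ^+ 2 * vol_density g x).
  rewrite /rel_vol -RintegralZl//; last by apply: iA; exact: measurable_rV_box.
  apply: le_Rintegral => //.
  - by have := integrableZl mD ((c ^+ n.+1) ^+ 2) (iA _ (measurable_rV_box
      (fun i => W (e k) * T (e k) i) (fun i => W (e k) * (T (e k) i + 1)))).
  - apply: (bounded_mul_integrable mD ivol (M := M)) => //.
      by apply: measurable_funX; have [] := mJ k.
    move=> x Dx; have /andP[h1 h2] := Nk k x Dx.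
    by rewrite ger0_norm ?sqr_ge0// (le_trans h1).
  - move=> x Dx; rewrite mulrA ler_wpM2r// indicE.
    have [xq|xq] := pselect (cell (W (e k)) (T (e k)) x); last first.
      by rewrite memNset// mulr0 sqr_ge0.
    have cf := cell_fun_ge c_gt0 Hc (W0 (e k)) xq.
    by rewrite mem_set// mulr1 ler_pXn2r// nnegrE ?(le_trans _ cf)// ltW.
apply: (biharmonic_neumann_le_disjoint mD ivol (f := f) (A := fun k => A (e k))
  (M := M) (K := K)) => //.
- by rewrite mulr_ge0 ?rayleigh_const_ge0// divr_ge0 ?exprn_ge0 ?ltW.
- move=> k l x Dx xk xl; apply: e_inj.
  exact: (star_disjoint a0 eps0 eps1 (ecol k l) xk xl).
- by move=> k x Dx; apply: cell_vanishes.
- by move=> k; exact: cell_fun_smooth.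
- by move=> k; exact: cell_energy_measurable.
- by move=> k; exact: cell_H2_density_measurable.
- by move=> k x Dx; rewrite (le_trans (ler_norm _))// Kk.
- by move=> k x Dx; rewrite (le_trans (Kk k x Dx))// le_max lexx.
- move=> k; have [ak _] := eM k; apply: lt_le_trans (mass_f k).
  by rewrite mulr_gt0// exprn_gt0.
- move=> k; have [ak bk] := eM k.
  have k4 : 0 <= kappa ^+ 4 / eps ^+ 4 by rewrite divr_ge0 ?exprn_ge0 ?ltW.
  have r0 : 0 <= rayleigh_const * (kappa ^+ 4 / eps ^+ 4).
    by rewrite mulr_ge0 ?rayleigh_const_ge0.
  apply: le_trans (ler_wpM2l r0 (mass_f k)).
  have K0 : 0 <= K.
    by have [x Dx] := D0; apply: le_trans (Kk k x Dx).
  apply: le_trans (ler_wpM2l K0 bk) _.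
  rewrite le_eqVlt; apply/orP; left; apply/eqP.
  by rewrite /rayleigh_const /K; field; rewrite gt_eqF//= gt_eqF.
Qed.

End eigenvalue_bound.

Theorem theorem5p17 (R : realType) (n : nat) :
  exists A B : R,
  forall (kappa : R) (Omega : set 'rV[R]_n.+1),
    0 < kappa ->
    is_domain half_space Omega ->
    riem_bounded half_space (hyp_metric kappa) Omega ->
    C1_boundary half_space Omega ->
  forall j : nat, (0 < j)%N ->
    (biharmonic_neumann (hyp_metric kappa) Omega j <=
     (A * (j%:R / fine (riem_volume (hyp_metric kappa) Omega))
            `^ (4%:R / n.+1%:R)
      + B * kappa ^+ 4)%:E)%E.
Proof.
have [H [c [c_gt0 dH Hb H0 Hc]]] := exists_bump (R := R).
(* The energy involves derivatives up to order 2 of each factor. *)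
have [C0 C0_ge0 HC0] := Hb 0%N; have [C1 C1_ge0 HC1] := Hb 1%N.
have [C2 C2_ge0 HC2] := Hb 2.
pose C := C0 + C1 + C2.
have C_ge0 : 0 <= C by rewrite !addr_ge0.
have HC (k : nat) t : (k <= 2)%N -> `|H k t| <= C.
  rewrite /C; case: k => [|[|[|//]]] _.
  - by rewrite (le_trans (HC0 t))// -addrA lerDl addr_ge0.
  - by rewrite (le_trans (HC1 t))// addrAC lerDr addr_ge0.
  - by rewrite (le_trans (HC2 t))// lerDr addr_ge0.
pose B := @rayleigh_const R n c C.
pose N : R := 2 * #|{ffun 'I_n.+1 -> 'I_3}|%:R.
have N_gt0 : 0 < N.
  by rewrite mulr_gt0// ltr0n card_ffun !card_ord expn_gt0.
exists (B * N `^ (4%:R / n.+1%:R)), B => kappa Omega kappa_gt0 [D0 DS oD _].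
move=> bD _ j j_gt0.
set V := fine (riem_volume _ _).
have V_gt0 : 0 < V.
  have [a [b [a0 b0 ab]]] := riem_bounded_coordinates kappa_gt0 bD.
  by apply: riem_volume_gt0 a0 b0 _ _ => // x /ab[].
(* With [rho^d = r], cells of scale [kappa / rho] have volume at most
   [V / (N j)]; the minimum with 1 accounts for the term in [kappa^4]. *)
pose r := N * (j%:R / V).
have r_gt0 : 0 < r by rewrite mulr_gt0// divr_gt0// ltr0n.
pose rho := r `^ (1 / n.+1%:R).
have rho_gt0 : 0 < rho by exact: powR_gt0.
have rhoX k : rho ^+ k = r `^ (k%:R / n.+1%:R).
  by rewrite -powR_mulrn ?(ltW rho_gt0)// -powRrM mulrAC mul1r.
pose eps := Num.min 1 (kappa / rho).
have eps_gt0 : 0 < eps by rewrite lt_min ltr01 divr_gt0.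
have eps_le1 : eps <= 1 by rewrite ge_min lexx.
apply: le_trans (neumann_le_at_scale dH c_gt0 C_ge0 HC H0 Hc kappa_gt0 DS oD D0 bD
  eps_gt0 eps_le1 j_gt0 _) _.
  rewrite -/V -/N.
  have eps_rho : eps / kappa <= rho^-1.
    by rewrite ler_pdivrMr// mulrC ge_min lexx orbT.
  apply: (@le_trans _ _ (j%:R * rho^-1 ^+ n.+1)).
    rewrite ler_wpM2l// ler_pXn2r// nnegrE ?divr_ge0 ?invr_ge0//; exact: ltW.
  rewrite exprVn rhoX divff ?pnatr_eq0// powRr1 ?(ltW r_gt0)// /r.
  rewrite le_eqVlt; apply/orP; left; apply/eqP; field.
  by rewrite !gt_eqF ?ltr0n.
rewrite lee_fin -/B.
have -> : B * N `^ (4%:R / n.+1%:R) * (j%:R / V) `^ (4%:R / n.+1%:R) = B * rho ^+ 4.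
  by rewrite -mulrA -powRM ?rhoX// ?divr_ge0 ?(ltW N_gt0)// ltW.
rewrite -mulrDr ler_wpM2l ?rayleigh_const_ge0//.
rewrite /eps /Num.min; case: ifP => _.
  by rewrite expr1n divr1 lerDr exprn_ge0// ltW.
rewrite [leLHS](_ : _ = rho ^+ 4) ?lerDl ?exprn_ge0 ?(ltW kappa_gt0)//.
by field; rewrite !gt_eqF.
Qed.
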